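(* Let $\mathfrak g=\mathfrak{osp}(V;\omega)$, let $M$ be a $\mathrm U(\mathfrak g)$-module, and let $\mathrm{sdim}=\mathrm{sdim}(V)$. With the functors $\mathcal F_M:\mathcal{PB}(\mathrm{sdim})\to\mathcal T_M(V)$ and $\mathcal F:\mathcal B(\mathrm{sdim})\to\mathcal T(V)$, the diagram of functors $$\begin{array}{ccc}\mathcal{PB}(\mathrm{sdim})\times\mathcal B(\mathrm{sdim})&\xrightarrow{\ \mathcal F_M\times\mathcal F\ }&\mathcal T_M(V)\times\mathcal T(V)\\ {\scriptstyle\otimes}\downarrow&&\downarrow{\scriptstyle\otimes}\\ \mathcal{PB}(\mathrm{sdim})&\xrightarrow{\ \mathcal F_M\ }&\mathcal T_M(V)\end{array}$$ commutes.
   Context: **Orthosymplectic Lie superalgebra.** $V=V_{\bar0}\oplus V_{\bar1}$ is a finite dimensional $\mathbb Z_2$-graded complex vector space with a non-degenerate even supersymmetric bilinear form $\omega$; $\mathrm{sdim}(V)=\dim V_{\bar0}-\dim V_{\bar1}$. $\mathfrak{osp}(V;\omega)$ is the Lie superalgebra spanned by the homogeneous $X\in\mathrm{End}_{\mathbb C}(V)$ with $\omega(Xu,w)+(-1)^{[X][u]}\omega(u,Xw)=0$. Let $\{e^a\}$ be a homogeneous basis of $V$, $[a]$ the parity of $e^a$, $g^{ab}=\omega(e^a,e^b)$, $(g_{ab})=(g^{ab})^{-1}$, $\{e_a\}$ the basis with $\omega(e_a,e^b)=\delta_a^b$, and $E^a_b$ the matrix units, $E^c_b(e^a)=\delta^a_be^c$.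 Let $X^a_b\in\mathfrak g\subset\mathrm U(\mathfrak g)$ be the element $E^a_b-(-1)^{[a][b]}\sum_{a',b'}g^{aa'}g_{bb'}E^{b'}_{a'}$. The tempered Casimir is $t=\frac12\sum_{a,b}X^a_b\otimes(-1)^{[b]}X^b_a$. $\mu_M$ is the representation on $M$; $\tau_{M,M'}(w\otimes w')=(-1)^{[w][w']}w'\otimes w$; $\hat C:V\otimes V\to\mathbb C$, $v\otimes v'\mapsto\omega(v,v')$; $\check C:\mathbb C\to V\otimes V$, $1\mapsto\sum_ae^a\otimes e_a$. $\mathcal T(V)$, $\mathcal T_M(V)$ are the full subcategories of $\mathrm U(\mathfrak g)$-modules with objects $V^{\otimes r}$, respectively $M\otimes V^{\otimes r}$, $r\in\mathbb N$; the usual tensor product gives a bi-functor $\mathcal T_M(V)\times\mathcal T(V)\to\mathcal T_M(V)$. **The category $\mathcal{MPB}(\delta)$.** Words are finite (possibly empty) sequences in the letters $m,v$; $v^r$ denotes $r$ copies of $v$. A coloured Brauer diagram from a word $s$ to a word $t$ is a perfect matching of the set of bottom points (one per letter of $s$, left to right) and top points (one per letter of $t$) such that matched points carry the same letter and two points in the same row are matched only if their letter is $v$. Let $\mathcal{C}$ be the $\mathbb C$-linear strict monoidal category with words as objects, these diagrams as a basis of $\mathrm{Hom}(s,t)$, composition $BA$ given by stacking $B$ on top of $A$ and replacing each closed loop by the factor $\delta$, and $\otimes$ given by concatenation/juxtaposition. Write $I(s)$ for identities, $I=I(v)$, $X_{a,b}:(a,b)\to(b,a)$ for the crossing, $X(s,t):(s,t)\to(t,s)$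 for the crossing of two blocks of parallel strands, $X=X_{v,v}$, $\cup:\emptyset\to(v,v)$, $\cap:(v,v)\to\emptyset$, $E=\cup\cap$. The multi-polar Brauer category $\mathcal{MPB}(\delta)$ is the $\mathbb C$-linear strict monoidal category obtained from $\mathcal C$ by freely adjoining morphisms $\mathbb H(a,b):(a,b)\to(a,b)$, $a,b\in\{m,v\}$, subject to, for all letters $a,b,c$ and words $w$: (i) $X(w,(a,b))(I(w)\otimes\mathbb H(a,b))=(\mathbb H(a,b)\otimes I(w))X(w,(a,b))$ and $X((a,b),w)(\mathbb H(a,b)\otimes I(w))=(I(w)\otimes\mathbb H(a,b))X((a,b),w)$; (ii) $X_{b,a}\mathbb H(b,a)=\mathbb H(a,b)X_{b,a}$; (iii) $(I\otimes\cap\otimes I(a))(X\otimes\mathbb H(v,a))(I\otimes\cup\otimes I(a))=-\mathbb H(v,a)$ and $(I(a)\otimes\cap\otimes I)(\mathbb H(a,v)\otimes X)(I(a)\otimes\cup\otimes I)=-\mathbb H(a,v)$; (iv) with $\mathbb H_{12}=\mathbb H(a,b)\otimes I(c)$, $\mathbb H_{23}=I(a)\otimes\mathbb H(b,c)$, $\mathbb H_{13}=(I(a)\otimes X_{c,b})(\mathbb H(a,c)\otimes I(b))(I(a)\otimes X_{b,c})$, one has $[\mathbb H_{12},\mathbb H_{13}+\mathbb H_{23}]=0=[\mathbb H_{12}+\mathbb H_{13},\mathbb H_{23}]$; (v) $\mathbb H(v,v)=X-E$. $\mathcal{PB}(\delta)$ is the full subcategory with objects $(m,v^r)$, and $\mathcal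 B(\delta)$ (the Brauer category) the full subcategory with objects $v^r$, $r\in\mathbb N$; the monoidal structure restricts to a bi-functor $\otimes:\mathcal{PB}(\delta)\times\mathcal B(\delta)\to\mathcal{PB}(\delta)$. **Functors.** For $\delta=\mathrm{sdim}(V)$ there is a monoidal functor from $\mathcal{MPB}(\delta)$ to $\mathrm U(\mathfrak g)$-modules with $m\mapsto M$, $v\mapsto V$, crossings $\mapsto$ the corresponding $\tau$, $\cup\mapsto\check C$, $\cap\mapsto\hat C$, and $\mathbb H(a,b)\mapsto(\mu_{A}\otimes\mu_{B})(t)$, where $A,B\in\{M,V\}$ are the images of $a,b$. $\mathcal F_M$ is its restriction to $\mathcal{PB}(\delta)$. $\mathcal F:\mathcal B(\delta)\to\mathcal T(V)$ is the monoidal functor with $r\mapsto V^{\otimes r}$, $I\mapsto\mathrm{id}_V$, $X\mapsto\tau_{V,V}$, $\cap\mapsto\hat C$, $\cup\mapsto\check C$. *)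

(* Defs.v *)
From HB Require Import structures.
From mathcomp Require Import all_boot all_order all_algebra.
From mathcomp Require Import boolp.
From mathcomp Require Import ring.
From mathcomp Require Import ssrAC.

Set Implicit Arguments.
Unset Strict Implicit.
Unset Printing Implicit Defensive.

Import GRing.Theory.
Local Open Scope ring_scope.
Local Open Scope quotient_scope.

Section LinearMaps.
Variables (K : fieldType) (U V W : lmodType K).
Implicit Types (f g : U -> V).

Lemma linD f : linear f -> {morph f : x y / x + y}.
Proof. by move=> lf x y; have := lf 1 x y; rewrite !scale1r. Qed.

Lemma lin0 f : linear f -> f 0 = 0.
Proof. by move=> lf; have := linD lf 0 0; rewrite addr0 -{1}[f 0]addr0 => /addrI. Qed.

Lemma linZ f : linear f -> forall a x, f (a *: x) = a *: f x.
Proof. by move=> lf a x; have := lf a x 0; rewrite !addr0 lin0 // addr0. Qed.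

Lemma linN f : linear f -> {morph f : x / - x}.
Proof. by move=> lf x; rewrite -scaleN1r linZ // scaleN1r. Qed.

Lemma linS f : linear f -> forall (I : Type) (r : seq I) (F : I -> U),
  f (\sum_(i <- r) F i) = \sum_(i <- r) f (F i).
Proof.
by move=> lf I r F; apply: (big_morph f (linD lf) (lin0 lf)).
Qed.

Lemma linear_id : linear (@id U). Proof. by []. Qed.

Lemma linear_comp f (h : V -> W) : linear f -> linear h -> linear (h \o f).
Proof. by move=> lf lh a x y /=; rewrite lf lh. Qed.

Lemma linear_add f g : linear f -> linear g -> linear (f \+ g).
Proof. by move=> lf lg a x y /=; rewrite lf lg scalerDr addrACA. Qed.

Lemma linear_scale f c : linear f -> linear (fun x => c *: f x).
Proof. by move=> lf a x y /=; rewrite lf scalerDr !scalerA mulrC. Qed.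

Lemma linear_zero : linear (fun _ : U => 0 : V).
Proof. by move=> a x y; rewrite scaler0 addr0. Qed.

Lemma linear_big (I : Type) (r : seq I) (F : I -> U -> V) :
  (forall i, linear (F i)) -> linear (fun x => \sum_(i <- r) F i x).
Proof.
move=> lF a x y; rewrite scaler_sumr -big_split /=.
by apply: eq_bigr => i _; rewrite lF.
Qed.

Definition bilinear_map (b : U -> V -> W) : Prop :=
  (forall v, linear (b^~ v)) /\ (forall u, linear (b u)).

End LinearMaps.

Section TensorProduct.
Variables (K : fieldType) (M N : lmodType K).

Definition formal_value (P : lmodType K) (b : M -> N -> P) (s : seq (M * N)) : P :=
  \sum_(x <- s) b x.1 x.2.

(* A list [:: (m1, n1); ...; (mk, nk)] stands for the formal sum of the
   m_i (x) n_i; two formal sums define the same tensor iff no bilinear map out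
   of M x N tells them apart. *)
Definition tens_eq (s t : seq (M * N)) : Prop :=
  forall (P : lmodType K) (b : M -> N -> P),
    bilinear_map b -> formal_value b s = formal_value b t.

Definition tens_eqb (s t : seq (M * N)) : bool := `[< tens_eq s t >].

Lemma tens_eqb_refl : reflexive tens_eqb.
Proof. by move=> s; apply/asboolP. Qed.

Lemma tens_eqb_sym : symmetric tens_eqb.
Proof.
move=> s t; apply/asboolP/asboolP => H P b hb; by rewrite (H P b hb).
Qed.

Lemma tens_eqb_trans : transitive tens_eqb.
Proof.
move=> t s u /asboolP H1 /asboolP H2; apply/asboolP => P b hb.
by rewrite (H1 P b hb) (H2 P b hb).
Qed.

Canonical tens_equiv := EquivRel tens_eqb tens_eqb_refl tens_eqb_sym tens_eqb_trans.

Definition tens : Type := {eq_quot tens_equiv}.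
HB.instance Definition _ : EqQuotient _ tens_equiv tens := EqQuotient.on tens.
HB.instance Definition _ := Choice.on tens.

Definition tpi (s : seq (M * N)) : tens := \pi_tens s.

Lemma tpiP s t : tens_eq s t -> tpi s = tpi t.
Proof. by move=> H; apply/eqP; rewrite eqmodE; apply/asboolP. Qed.

Lemma tpi_repr z : tpi (repr z) = z.
Proof. exact: reprK. Qed.

Lemma repr_tpi s : tens_eq (repr (tpi s)) s.
Proof.
have /eqP : tpi (repr (tpi s)) = tpi s by rewrite tpi_repr.
by rewrite eqmodE => /asboolP.
Qed.

Definition tadd (x y : tens) : tens := tpi (repr x ++ repr y).
Definition tscale (a : K) (x : tens) : tens :=
  tpi [seq (a *: u.1, u.2) | u <- repr x].

Lemma fv_cat (P : lmodType K) (b : M -> N -> P) s t :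
  formal_value b (s ++ t) = formal_value b s + formal_value b t.
Proof. by rewrite /formal_value big_cat. Qed.

Lemma fv_scale (P : lmodType K) (b : M -> N -> P) a s : bilinear_map b ->
  formal_value b [seq (a *: u.1, u.2) | u <- s] = a *: formal_value b s.
Proof.
case=> hl _; rewrite /formal_value big_map scaler_sumr.
by apply: eq_bigr => u _ /=; exact: (linZ (hl u.2)).
Qed.

Lemma fv_tadd (P : lmodType K) (b : M -> N -> P) x y : bilinear_map b ->
  formal_value b (repr (tadd x y)) = formal_value b (repr x) + formal_value b (repr y).
Proof. by move=> hb; rewrite (repr_tpi _ hb) fv_cat. Qed.

Lemma fv_tscale (P : lmodType K) (b : M -> N -> P) a x : bilinear_map b ->
  formal_value b (repr (tscale a x)) = a *: formal_value b (repr x).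
Proof. by move=> hb; rewrite (repr_tpi _ hb) fv_scale. Qed.

Lemma fv_nil (P : lmodType K) (b : M -> N -> P) : bilinear_map b ->
  formal_value b (repr (tpi [::])) = 0.
Proof. by move=> hb; rewrite (repr_tpi _ hb) /formal_value big_nil. Qed.

Lemma tens_fv_inj (x y : tens) :
  (forall (P : lmodType K) (b : M -> N -> P), bilinear_map b ->
     formal_value b (repr x) = formal_value b (repr y)) -> x = y.
Proof. by move=> H; rewrite -(tpi_repr x) -(tpi_repr y); apply: tpiP. Qed.

Fact taddA : associative tadd.
Proof. by move=> x y z; apply: tens_fv_inj => P b hb; rewrite !fv_tadd ?addrA. Qed.
Fact taddC : commutative tadd.
Proof. by move=> x y; apply: tens_fv_inj => P b hb; rewrite !fv_tadd // addrC. Qed.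
Fact tadd0 : left_id (tpi [::]) tadd.
Proof. by move=> x; apply: tens_fv_inj => P b hb; rewrite !fv_tadd // fv_nil ?add0r. Qed.
Fact taddN : left_inverse (tpi [::]) (tscale (-1)) tadd.
Proof.
by move=> x; apply: tens_fv_inj => P b hb;
  rewrite fv_tadd // fv_tscale // fv_nil // scaleN1r addNr.
Qed.

HB.instance Definition _ := GRing.isZmodule.Build tens taddA taddC tadd0 taddN.

Fact tscaleA a c x : tscale a (tscale c x) = tscale (a * c) x.
Proof. by apply: tens_fv_inj => P b hb; rewrite !fv_tscale // scalerA. Qed.
Fact tscale1 : left_id 1 tscale.
Proof. by move=> x; apply: tens_fv_inj => P b hb; rewrite !fv_tscale // scale1r. Qed.
Fact tscaleDr : right_distributive tscale +%R.
Proof.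
by move=> a x y; apply: tens_fv_inj => P b hb;
  rewrite fv_tscale // !fv_tadd // !fv_tscale // scalerDr.
Qed.
Fact tscaleDl x : {morph tscale^~ x : a c / a + c}.
Proof.
by move=> a c; apply: tens_fv_inj => P b hb;
  rewrite fv_tscale // fv_tadd // !fv_tscale // scalerDl.
Qed.

HB.instance Definition _ :=
  GRing.Zmodule_isLmodule.Build K tens tscaleA tscale1 tscaleDr tscaleDl.

Definition tpure (m : M) (n : N) : tens := tpi [:: (m, n)].

Definition tlift (P : lmodType K) (b : M -> N -> P) (z : tens) : P :=
  formal_value b (repr z).

Lemma tpure_bilin : bilinear_map tpure.
Proof.
split=> [n a x y|m a x y]; apply: tens_fv_inj => P b hb;
  have [hl hr] := hb; rewrite fv_tadd // fv_tscale // !(repr_tpi _ hb);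
  rewrite /formal_value !big_seq1 /=; [exact: hl | exact: hr].
Qed.

Lemma tlift_linear (P : lmodType K) (b : M -> N -> P) :
  bilinear_map b -> linear (tlift b).
Proof. by move=> hb a x y; rewrite /tlift fv_tadd // fv_tscale. Qed.

Lemma tlift_pure (P : lmodType K) (b : M -> N -> P) m n :
  bilinear_map b -> tlift b (tpure m n) = b m n.
Proof. by move=> hb; rewrite /tlift (repr_tpi _ hb) /formal_value big_seq1. Qed.

Lemma tens_pure_sum (z : tens) : z = \sum_(x <- repr z) tpure x.1 x.2.
Proof.
apply: tens_fv_inj => P b hb; rewrite -/(tlift b _) -/(tlift b _).
rewrite (linS (tlift_linear hb)); apply: eq_bigr => x _.
by rewrite tlift_pure.
Qed.

Lemma tens_ext (P : lmodType K) (f g : tens -> P) : linear f -> linear g ->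
  (forall m n, f (tpure m n) = g (tpure m n)) -> f =1 g.
Proof.
move=> lf lg H z; rewrite (tens_pure_sum z) (linS lf) (linS lg).
by apply: eq_bigr => x _.
Qed.

End TensorProduct.

Arguments tpure {K M N} m n.

Section TensorMap.
Variable K : fieldType.

Definition tmap (M N M' N' : lmodType K) (f : M -> M') (g : N -> N') :
  tens M N -> tens M' N' := tlift (fun m n => tpure (f m) (g n)).

Variables (M N M' N' : lmodType K) (f : M -> M') (g : N -> N').
Hypotheses (lf : linear f) (lg : linear g).

Lemma tmap_bilin : bilinear_map (fun m n => tpure (f m) (g n)).
Proof.
have [hl hr] := tpure_bilin M' N'.
split=> [n a x y|m a x y]; rewrite ?lf ?lg; [exact: hl | exact: hr].
Qed.

Lemma tmap_linear : linear (tmap f g).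
Proof. exact: tlift_linear tmap_bilin. Qed.

Lemma tmapE m n : tmap f g (tpure m n) = tpure (f m) (g n).
Proof. by rewrite /tmap tlift_pure //; exact: tmap_bilin. Qed.

End TensorMap.

(* A Z/2-grading, given by the two projections onto the homogeneous parts;
   [false] is the even parity. *)
Record grading (K : fieldType) (U : lmodType K) := Grading {
  gproj : bool -> U -> U;
  gproj_linear : forall p, linear (gproj p);
  gproj_sum : forall u, gproj false u + gproj true u = u;
  gproj_proj : forall p q u,
    gproj p (gproj q u) = if p == q then gproj q u else 0 }.

Record superspace (K : fieldType) := Superspace {
  ssort :> lmodType K;
  sgrading : grading ssort }.

Definition proj (K : fieldType) (S : superspace K) (p : bool) : S -> S :=
  gproj (sgrading S) p.

(* Multiplication of homogeneous vectors u by (-1)^(p [u]). *)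
Definition parity_sign (K : fieldType) (S : superspace K) (p : bool) (u : S) : S :=
  proj false u + (-1) ^+ p *: proj true u.

Record ortho_space (K : fieldType) := OrthoSpace {
  osort :> vectType K;
  ograding : grading osort;
  omega : osort -> osort -> K;
  omega_linear_l : forall w, linear (omega^~ w : osort -> K^o);
  omega_linear_r : forall u, linear (omega u : osort -> K^o);
  omega_even : forall u w, omega (gproj ograding false u) (gproj ograding true w) = 0
                        /\ omega (gproj ograding true u) (gproj ograding false w) = 0;
  omega_supersym : forall p q u w,
    omega (gproj ograding p u) (gproj ograding q w)
      = (-1) ^+ (p && q) * omega (gproj ograding q w) (gproj ograding p u);
  omega_nondeg : forall u, (forall w, omega u w = 0) -> u = 0 }.

Definition oproj (K : fieldType) (V : ortho_space K) (p : bool) : V -> V :=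
  gproj (ograding V) p.

Definition sdim (K : fieldType) (V : ortho_space K) : int :=
  (\dim (limg (linfun (@oproj K V false))))%:Z
    - (\dim (limg (linfun (@oproj K V true))))%:Z.

Section SuperspaceTheory.
Variables (K : fieldType) (S : superspace K).

Lemma proj_linear p : linear (@proj K S p). Proof. exact: gproj_linear. Qed.
Lemma proj_sum (u : S) : proj false u + proj true u = u. Proof. exact: gproj_sum. Qed.
Lemma proj_proj p q (u : S) : proj p (proj q u) = if p == q then proj q u else 0.
Proof. exact: gproj_proj. Qed.

Lemma parity_sign_linear p : linear (@parity_sign K S p).
Proof.
move=> a x y; rewrite /parity_sign !proj_linear !scalerDr !scalerA addrACA.
by rewrite [_ * a]mulrC.
Qed.

Lemma parity_sign_proj p q (u : S) :
  parity_sign p (proj q u) = (-1) ^+ (p && q) *: proj q u.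
Proof.
rewrite /parity_sign !proj_proj; case: q => /=.
  by rewrite andbT add0r.
by rewrite andbF expr0 scaler0 addr0 scale1r.
Qed.

Lemma proj_parity_sign p q (u : S) :
  proj q (parity_sign p u) = parity_sign p (proj q u).
Proof.
rewrite /parity_sign (linD (proj_linear q)) (linZ (proj_linear q)) !proj_proj.
by case: q => /=; rewrite ?scaler0.
Qed.

Lemma super_ext (P : lmodType K) (f g : S -> P) : linear f -> linear g ->
  (forall p u, f (proj p u) = g (proj p u)) -> f =1 g.
Proof.
by move=> lf lg H u; rewrite -(proj_sum u) (linD lf) (linD lg) !H.
Qed.

End SuperspaceTheory.

Section OSP.
Variables (K : fieldType) (V : ortho_space K).

Lemma oproj_linear p : linear (@oproj K V p). Proof. exact: gproj_linear. Qed.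
Lemma oproj_sum (u : V) : oproj false u + oproj true u = u. Proof. exact: gproj_sum. Qed.
Lemma oproj_oproj p q (u : V) : oproj p (oproj q u) = if p == q then oproj q u else 0.
Proof. exact: gproj_proj. Qed.

Definition homogeneous_end (p : bool) (X : 'End(V)) : Prop :=
  forall q (u : V), X (oproj q u) = oproj (q (+) p) (X u).

Definition osp_condition (p : bool) (X : 'End(V)) : Prop :=
  homogeneous_end p X /\
  forall q (u w : V),
    omega (X (oproj q u)) w + (-1) ^+ (p && q) * omega (oproj q u) (X w) = 0.

(* The homogeneous part of parity p of osp(V; omega); the Lie superalgebra is
   the direct sum of [osp V false] and [osp V true]. *)
Record osp (p : bool) := Osp { osp_end :> 'End(V); ospP : osp_condition p osp_end }.

Lemma osp_lin_subproof p (a : K) (x y : osp p) : osp_condition p (a *: (x : 'End(V)) + y).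
Proof.
have [hx cx] := ospP x; have [hy cy] := ospP y.
split=> [q u|q u w]; rewrite !add_lfunE !scale_lfunE.
  by rewrite hx hy -(gproj_linear (ograding V)).
rewrite (omega_linear_l w) (omega_linear_r (oproj q u)) mulrDr addrACA cy addr0.
by rewrite mulrCA -mulrDr cx mulr0.
Qed.

Definition osp_lin p a (x y : osp p) : osp p := Osp (osp_lin_subproof a x y).

Lemma osp_bracket_subproof p q (x : osp p) (y : osp q) :
  osp_condition (p (+) q)
    ((x \o y)%VF - (-1) ^+ (p && q) *: (y \o x)%VF).
Proof.
have [hx cx] := ospP x; have [hy cy] := ospP y.
have oZl a u w : omega (a *: u) w = a * omega (u : V) (w : V).
  exact: (linZ (@omega_linear_l K V w)).
have oZr a u w : omega u (a *: w) = a * omega (u : V) (w : V).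
  exact: (linZ (@omega_linear_r K V u)).
have oDl u u' w : omega (u + u') w = omega u w + omega (u' : V) (w : V).
  exact: (linD (@omega_linear_l K V w)).
have oDr u w w' : omega u (w + w') = omega u w + omega (u : V) (w' : V).
  exact: (linD (@omega_linear_r K V u)).
split=> [r u|r u w]; rewrite -scaleNr !add_lfunE !scale_lfunE !comp_lfunE.
  rewrite hx hy hx hy (linD (oproj_linear _)) (linZ (oproj_linear _)).
  by rewrite -!addbA [q (+) p]addbC.
rewrite oDl oDr oZl oZr.
have sx r' u' w' : omega (x (oproj r' u')) w'
    = - ((-1) ^+ (p && r') * omega (oproj r' u') (x w')).
  by apply/eqP; rewrite -addr_eq0 cx.
have sy r' u' w' : omega (y (oproj r' u')) w'
    = - ((-1) ^+ (q && r') * omega (oproj r' u') (y w')).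
  by apply/eqP; rewrite -addr_eq0 cy.
rewrite [y (oproj _ _)]hy sx -hy sy [x (oproj _ _)]hx sy -hx sx.
move: (omega _ (x _)) (omega _ (y _)) => A B.
clear; by case: p; case: q; case: r; rewrite /= ?expr0 ?expr1; ring.
Qed.

Definition osp_bracket p q (x : osp p) (y : osp q) : osp (p (+) q) :=
  Osp (osp_bracket_subproof x y).

(* U(osp(V; omega)) is the quotient of these expressions by [uea_eq]. *)
Inductive uea : Type :=
| Ugen p of osp p
| Uzero
| Uone
| Uadd of uea & uea
| Uscale of K & uea
| Umul of uea & uea.

Inductive uea_eq : uea -> uea -> Prop :=
| Ueq_refl s : uea_eq s s
| Ueq_sym s t : uea_eq s t -> uea_eq t s
| Ueq_trans s t u : uea_eq s t -> uea_eq t u -> uea_eq s u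
| Ueq_add s s' t t' : uea_eq s s' -> uea_eq t t' -> uea_eq (Uadd s t) (Uadd s' t')
| Ueq_scale a s s' : uea_eq s s' -> uea_eq (Uscale a s) (Uscale a s')
| Ueq_mul s s' t t' : uea_eq s s' -> uea_eq t t' -> uea_eq (Umul s t) (Umul s' t')
| UaddA s t u : uea_eq (Uadd s (Uadd t u)) (Uadd (Uadd s t) u)
| UaddC s t : uea_eq (Uadd s t) (Uadd t s)
| Uadd0 s : uea_eq (Uadd Uzero s) s
| Uscale0 s : uea_eq (Uscale 0 s) Uzero
| Uscale1 s : uea_eq (Uscale 1 s) s
| UscaleA a b s : uea_eq (Uscale a (Uscale b s)) (Uscale (a * b) s)
| UscaleDl a b s : uea_eq (Uscale (a + b) s) (Uadd (Uscale a s) (Uscale b s))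
| UscaleDr a s t : uea_eq (Uscale a (Uadd s t)) (Uadd (Uscale a s) (Uscale a t))
| UmulA s t u : uea_eq (Umul s (Umul t u)) (Umul (Umul s t) u)
| Umul1l s : uea_eq (Umul Uone s) s
| Umul1r s : uea_eq (Umul s Uone) s
| UmulDl s t u : uea_eq (Umul (Uadd s t) u) (Uadd (Umul s u) (Umul t u))
| UmulDr s t u : uea_eq (Umul s (Uadd t u)) (Uadd (Umul s t) (Umul s u))
| UscaleAl a s t : uea_eq (Umul (Uscale a s) t) (Uscale a (Umul s t))
| UscaleAr a s t : uea_eq (Umul s (Uscale a t)) (Uscale a (Umul s t))
| Ugen_linear p a (x y : osp p) :
    uea_eq (Ugen (osp_lin a x y)) (Uadd (Uscale a (Ugen x)) (Ugen y))
| Ugen_bracket p q (x : osp p) (y : osp q) :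
    uea_eq (Umul (Ugen x) (Ugen y))
      (Uadd (Uscale ((-1) ^+ (p && q)) (Umul (Ugen y) (Ugen x)))
            (Ugen (osp_bracket x y))).

(* Z/2-graded left U(g)-modules. *)
Record umodule := UModule {
  usuper :> superspace K;
  uact : uea -> usuper -> usuper;
  uact_linear : forall s, linear (uact s);
  uact_eq : forall s t, uea_eq s t -> uact s =1 uact t;
  uact0 : forall u, uact Uzero u = 0;
  uact1 : forall u, uact Uone u = u;
  uactD : forall s t u, uact (Uadd s t) u = uact s u + uact t u;
  uactZ : forall a s u, uact (Uscale a s) u = a *: uact s u;
  uactM : forall s t u, uact (Umul s t) u = uact s (uact t u);
  uact_graded : forall p (x : osp p) q u,
    uact (Ugen x) (proj q u) = proj (q (+) p) (uact (Ugen x) u) }.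

Section FromLieAction.
Variables (S : superspace K) (act : forall p, osp p -> S -> S).
Hypothesis act_linear : forall p (x : osp p), linear (act x).
Hypothesis act_lin : forall p a (x y : osp p) u,
  act (osp_lin a x y) u = a *: act x u + act y u.
Hypothesis act_bracket : forall p q (x : osp p) (y : osp q) u,
  act x (act y u) = (-1) ^+ (p && q) *: act y (act x u) + act (osp_bracket x y) u.
Hypothesis act_graded : forall p (x : osp p) q u,
  act x (proj q u) = proj (q (+) p) (act x u).

Fixpoint uea_extend (s : uea) (u : S) : S :=
  match s with
  | Ugen p x => act x u
  | Uzero => 0
  | Uone => u
  | Uadd s t => uea_extend s u + uea_extend t u
  | Uscale a s => a *: uea_extend s u
  | Umul s t => uea_extend s (uea_extend t u)
  end.

Lemma uea_extend_linear s : linear (uea_extend s).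
Proof.
elim: s => [p x|||s hs t ht|c s hs|s hs t ht] a u w //=.
- exact: act_linear.
- by rewrite scaler0 addr0.
- by rewrite hs ht scalerDr addrACA.
- by rewrite hs scalerDr !scalerA mulrC.
- by rewrite ht hs.
Qed.

Lemma uea_extend_eq s t : uea_eq s t -> uea_extend s =1 uea_extend t.
Proof.
elim=> {s t} //=.
- by move=> s t _ H u; rewrite H.
- by move=> s t r _ H1 _ H2 u; rewrite H1 H2.
- by move=> s s' t t' _ H1 _ H2 u; rewrite H1 H2.
- by move=> a s s' _ H u; rewrite H.
- by move=> s s' t t' _ H1 _ H2 u; rewrite H2 H1.
- by move=> s t r u; rewrite addrA.
- by move=> s t u; rewrite addrC.
- by move=> s u; rewrite add0r.
- by move=> s u; rewrite scale0r.
- by move=> s u; rewrite scale1r.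
- by move=> a b s u; rewrite scalerA.
- by move=> a b s u; rewrite scalerDl.
- by move=> a s t u; rewrite scalerDr.
- by move=> s t r u; rewrite (linD (uea_extend_linear s)).
- by move=> a s t u; rewrite (linZ (uea_extend_linear s)).
Qed.

Definition umodule_of_action : umodule :=
  @UModule S uea_extend uea_extend_linear uea_extend_eq
    (fun=> erefl) (fun=> erefl) (fun _ _ _ => erefl) (fun _ _ _ => erefl)
    (fun _ _ _ => erefl) act_graded.

End FromLieAction.

Lemma ground_projP (p q : bool) (u : K^o) :
  (if p then 0 else if q then 0 else u) =
  (if p == q then (if q then 0 else u) else 0).
Proof. by case: p q => [] []. Qed.

Lemma ground_proj_linear (p : bool) : linear (fun u : K^o => if p then 0 else u : K^o).
Proof. by case: p => a x y //=; rewrite scaler0 addr0. Qed.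

Definition ground_super : superspace K :=
  @Superspace K K^o (@Grading K K^o (fun p u => if p then 0 else u)
    ground_proj_linear (fun u => addr0 u) ground_projP).

Lemma ground_lin p a (x y : osp p) (u : ground_super) : (0 : K^o) = a *: (0 : K^o) + 0.
Proof. by rewrite scaler0 addr0. Qed.
Lemma ground_act_graded p (x : osp p) q (u : ground_super) :
  0 = proj (q (+) p) (0 : ground_super).
Proof. by rewrite (lin0 (proj_linear _)). Qed.

Definition ground_module : umodule :=
  @umodule_of_action ground_super (fun p (_ : osp p) _ => 0)
    (fun p _ => @linear_zero K _ _) ground_lin
    (fun p q x y u => ground_lin ((-1) ^+ (p && q)) (osp_bracket x y) (osp_bracket x y) u) ground_act_graded.

Definition natural_super : superspace K := Superspace (ograding V).

Lemma natural_lin p a (x y : osp p) (u : natural_super) :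
  osp_lin a x y u = a *: (x u : V) + y u.
Proof. by rewrite add_lfunE scale_lfunE. Qed.
Lemma natural_bracket p q (x : osp p) (y : osp q) (u : natural_super) :
  x (y u) = (-1) ^+ (p && q) *: (y (x u) : V) + osp_bracket x y u.
Proof.
by rewrite /= !add_lfunE opp_lfunE scale_lfunE !comp_lfunE addrC subrK.
Qed.
Lemma natural_linear p (x : osp p) : linear (x : natural_super -> natural_super).
Proof. by move=> a u w; rewrite linearP. Qed.
Lemma natural_graded p (x : osp p) q (u : natural_super) :
  x (proj q u) = proj (q (+) p) (x u : natural_super).
Proof. exact: (proj1 (ospP x)). Qed.

Definition natural_module : umodule :=
  umodule_of_action natural_linear natural_lin natural_bracket natural_graded.

End OSP.

Arguments Ugen {K V p}.
Arguments uact {K V} _ _ _.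

Section SuperTensor.
Variable K : fieldType.

Section Grading.
Variables S T : superspace K.

Definition tproj (p : bool) (z : tens S T) : tens S T :=
  \sum_(q : bool) tmap (@proj K S q) (@proj K T (q (+) p)) z.

Lemma tproj_linear p : linear (tproj p).
Proof.
by apply: linear_big => q; apply: tmap_linear; exact: proj_linear.
Qed.

Lemma tproj_pure p u w :
  tproj p (tpure u w) = tpure (proj false u) (proj p w) + tpure (proj true u) (proj (~~ p) w).
Proof.
rewrite /tproj big_bool /= !tmapE; try exact: proj_linear.
by rewrite addrC; case: p.
Qed.

Lemma tproj_hom p q r (u : S) (w : T) :
  tproj p (tpure (proj q u) (proj r w)) =
  if p == q (+) r then tpure (proj q u) (proj r w) else 0.
Proof.
have [hl hr] := tpure_bilin S T.
rewrite tproj_pure !proj_proj.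
by case: p q r => [] [] [] /=;
  rewrite ?(lin0 (hl _)) ?(lin0 (hr _)) ?addr0 ?add0r.
Qed.

Lemma super_tens_ext (P : lmodType K) (f g : tens S T -> P) : linear f -> linear g ->
  (forall p q u w, f (tpure (proj p u) (proj q w)) = g (tpure (proj p u) (proj q w))) ->
  f =1 g.
Proof.
move=> lf lg H; apply: tens_ext => // u w.
have [hl hr] := tpure_bilin S T.
rewrite -(proj_sum u) -(proj_sum w) !(linD (hl _)) !(linD (hr _)).
by rewrite !(linD lf) !(linD lg) !H.
Qed.

Lemma tproj_sum z : tproj false z + tproj true z = z.
Proof.
apply: (super_tens_ext (f := tproj false \+ tproj true) (g := id)) z => //.
  by apply: linear_add; exact: tproj_linear.
by move=> p q u w /=; rewrite !tproj_hom; case: p q => [] [] /=; rewrite ?addr0 ?add0r.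
Qed.

Lemma tproj_proj p q z : tproj p (tproj q z) = if p == q then tproj q z else 0.
Proof.
apply: (super_tens_ext (f := tproj p \o tproj q)
  (g := fun z => if p == q then tproj q z else 0)) z.
- by apply: linear_comp; exact: tproj_linear.
- by case: (p == q); [exact: tproj_linear | exact: linear_zero].
move=> r s u w /=; rewrite !tproj_hom.
case: (altP (q =P r (+) s)) => [->|_].
  by rewrite tproj_hom; case: eqP.
by rewrite (lin0 (tproj_linear p)); case: eqP.
Qed.

Definition tens_super : superspace K :=
  Superspace (Grading tproj_linear tproj_sum tproj_proj).

End Grading.

(* The graded tensor product of operators:
   (f (x) g) (u (x) w) = (-1)^([g][u]) f u (x) g w, for g of parity p. *)
Definition super_tmap (S T : superspace K) (f : S -> S) (p : bool) (g : T -> T) :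
  tens_super S T -> tens_super S T := tmap (f \o @parity_sign K S p) g.

Section Action.
Variables (V : ortho_space K) (A B : umodule V).

Let S := tens_super A B.

Definition tens_act p (x : osp V p) (z : S) : S :=
  super_tmap (uact A (Ugen x)) false (@id B) z
    + super_tmap (@id A) p (uact B (Ugen x)) z.

Lemma super_tmap_linear (f : A -> A) p (g : B -> B) : linear f -> linear g ->
  linear (super_tmap f p g).
Proof.
move=> lf lg; apply: tmap_linear => //; apply: linear_comp => //.
exact: parity_sign_linear.
Qed.

Lemma super_tmapE (f : A -> A) p (g : B -> B) u w : linear f -> linear g ->
  super_tmap f p g (tpure u w) = tpure (f (parity_sign p u)) (g w).
Proof.
move=> lf lg; rewrite /super_tmap tmapE //; apply: linear_comp => //.
exact: parity_sign_linear.
Qed.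

Lemma tens_act_linear p (x : osp V p) : linear (tens_act x).
Proof.
by apply: linear_add; apply: super_tmap_linear => //; exact: uact_linear.
Qed.

Lemma tens_act_hom p (x : osp V p) q (u : A) (w : B) : proj q u = u ->
  tens_act x (tpure u w) =
    tpure (uact A (Ugen x) u) w + (-1) ^+ (p && q) *: tpure u (uact B (Ugen x) w).
Proof.
have [hl hr] := tpure_bilin A B.
move=> <-; rewrite /tens_act !super_tmapE //; try exact: uact_linear.
by rewrite !parity_sign_proj /= expr0 scale1r (linZ (hl _)).
Qed.

Lemma proj_id q (S' : superspace K) (u : S') : proj q (proj q u) = proj q u.
Proof. by rewrite proj_proj eqxx. Qed.

Lemma uact_hom (C : umodule V) p (x : osp V p) q (u : C) : proj q u = u ->
  proj (q (+) p) (uact C (Ugen x) u) = uact C (Ugen x) u.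
Proof. by move=> hu; rewrite -uact_graded hu. Qed.

Lemma uact_lin (C : umodule V) p a (x y : osp V p) u :
  uact C (Ugen (osp_lin a x y)) u = a *: uact C (Ugen x) u + uact C (Ugen y) u.
Proof. by rewrite (uact_eq (Ugen_linear a x y)) uactD uactZ. Qed.

Lemma uact_bracket (C : umodule V) p q (x : osp V p) (y : osp V q) u :
  uact C (Ugen x) (uact C (Ugen y) u) =
  (-1) ^+ (p && q) *: uact C (Ugen y) (uact C (Ugen x) u)
    + uact C (Ugen (osp_bracket x y)) u.
Proof. by rewrite -!uactM (uact_eq (Ugen_bracket x y)) uactD uactZ. Qed.

Lemma tens_act_lin p a (x y : osp V p) z :
  tens_act (osp_lin a x y) z = a *: tens_act x z + tens_act y z.
Proof.
have [hl hr] := tpure_bilin A B.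
apply: (super_tens_ext (f := tens_act (osp_lin a x y))
  (g := (fun z => a *: tens_act x z) \+ tens_act y)) z.
- exact: tens_act_linear.
- apply: linear_add; [apply: linear_scale|]; exact: tens_act_linear.
move=> q r u w /=; rewrite !(@tens_act_hom _ _ q); try exact: proj_id.
rewrite !uact_lin hl hr.
rewrite !scalerDr addrACA; congr (_ + (_ + _)).
by rewrite !scalerA mulrC.
Qed.

Lemma tens_act_bracket p q (x : osp V p) (y : osp V q) z :
  tens_act x (tens_act y z) =
  (-1) ^+ (p && q) *: tens_act y (tens_act x z) + tens_act (osp_bracket x y) z.
Proof.
have [hl hr] := tpure_bilin A B.
have hlZ a m n : tpure (a *: m) n = a *: (tpure m n : tens A B) by apply: (linZ (hl n)).
have hrZ a m n : tpure m (a *: n) = a *: (tpure m n : tens A B) by apply: (linZ (hr m)).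
have hlD m m' n : tpure (m + m') n = (tpure m n : tens A B) + tpure m' n.
  by apply: (linD (hl n)).
have hrD m n n' : tpure m (n + n') = (tpure m n : tens A B) + tpure m n'.
  by apply: (linD (hr m)).
apply: (super_tens_ext (f := tens_act x \o tens_act y)
  (g := (fun z => (-1) ^+ (p && q) *: tens_act y (tens_act x z))
          \+ tens_act (osp_bracket x y))) z.
- by apply: linear_comp; exact: tens_act_linear.
- apply: linear_add; last exact: tens_act_linear.
  apply: (linear_scale (f := tens_act y \o tens_act x)).
  by apply: linear_comp; exact: tens_act_linear.
move=> r s u0 w /=.
move: (proj r u0) (proj_id r u0) (proj s w) => u hu {}w.
have hx := uact_hom x hu; have hy := uact_hom y hu.
rewrite !(tens_act_hom _ _ hu) !(linD (tens_act_linear _)) !(linZ (tens_act_linear _)).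
rewrite !(tens_act_hom _ _ hx) !(tens_act_hom _ _ hy) !(tens_act_hom _ _ hu).
rewrite !(uact_bracket x y) hlD hrD hlZ hrZ !scalerDr !scalerA.
have e1 : (-1) ^+ (p && (r (+) q)) = (-1) ^+ (p && q) * (-1) ^+ (p && r) :> K.
  by clear; case: p; case: q; case: r; rewrite /= ?expr0 ?expr1 ?mulrNN ?mulr1 ?mul1r.
have e2 : (-1) ^+ (p && q) * (-1) ^+ (q && (r (+) p)) = (-1) ^+ (q && r) :> K.
  by clear; case: p; case: q; case: r; rewrite /= ?expr0 ?expr1 ?mulrNN ?mulr1 ?mul1r.
have e3 : (-1) ^+ ((p (+) q) && r) = (-1) ^+ (q && r) * (-1) ^+ (p && r) :> K.
  by clear; case: p; case: q; case: r; rewrite /= ?expr0 ?expr1 ?mulrNN ?mulr1 ?mul1r.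
have e4 : (-1) ^+ (q && r) * (-1) ^+ (p && r) * (-1) ^+ (p && q)
    = (-1) ^+ (p && q) * (-1) ^+ (p && r) * (-1) ^+ (q && r) :> K.
  by rewrite mulrC mulrA mulrAC.
rewrite e1 e2 e3 e4 [LHS](AC (3*(1*2)) ((1*4)*(3*5)*(2*6))).
by [].
Qed.

Lemma tens_act_graded p (x : osp V p) q z :
  tens_act x (proj q z) = proj (q (+) p) (tens_act x z).
Proof.
apply: (super_tens_ext (f := tens_act x \o (@proj K S q))
  (g := (@proj K S (q (+) p)) \o tens_act x)) z.
- by apply: linear_comp; [exact: (@proj_linear K S q) | exact: tens_act_linear].
- by apply: linear_comp; [exact: tens_act_linear | exact: (@proj_linear K S _)].
move=> r s u w.
rewrite (_ : (_ \o _) _ = tens_act x (tproj q (tpure (proj r u) (proj s w)))) //.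
rewrite (_ : (_ \o _) _ = tproj (q (+) p) (tens_act x (tpure (proj r u) (proj s w)))) //.
rewrite (tens_act_hom _ _ (proj_id _ _)) (linD (tproj_linear _)) (linZ (tproj_linear _)).
have E a b : (a (+) p == b (+) p) = (a == b) by clear; case: a; case: b; case: p.
rewrite !uact_graded !tproj_hom addbAC addbA !E.
case: eqP => _; last by rewrite (lin0 (tens_act_linear x)) scaler0 addr0.
by rewrite (tens_act_hom _ _ (proj_id _ _)) !uact_graded.
Qed.

Definition tens_module : umodule V :=
  umodule_of_action tens_act_linear tens_act_lin tens_act_bracket tens_act_graded.

End Action.
End SuperTensor.

Section Homs.
Variables (K : fieldType) (V : ortho_space K).
Implicit Types A B C : umodule V.

(* Morphisms of graded modules are even. *)
Record module_hom A B := ModuleHom {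
  mhom :> A -> B;
  mhom_linear : linear mhom;
  mhom_even : forall p u, mhom (proj p u) = proj p (mhom u);
  mhom_uact : forall s u, mhom (uact A s u) = uact B s (mhom u) }.

Definition hom_id A : module_hom A A :=
  @ModuleHom A A id (@linear_id K A) (fun _ _ => erefl) (fun _ _ => erefl).

Program Definition hom_comp A B C (g : module_hom B C) (f : module_hom A B) :
  module_hom A C := @ModuleHom A C (g \o f) _ _ _.
Next Obligation. by apply: linear_comp; exact: mhom_linear. Qed.
Next Obligation. by rewrite !mhom_even. Qed.
Next Obligation. by rewrite !mhom_uact. Qed.

Lemma uact_gens A B (f : A -> B) : linear f ->
  (forall p (x : osp V p) u, f (uact A (Ugen x) u) = uact B (Ugen x) (f u)) ->
  forall s u, f (uact A s u) = uact B s (f u).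
Proof.
move=> lf H; elim=> [p x|||s hs t ht|c s hs|s hs t ht] u.
- exact: H.
- by rewrite !uact0 (lin0 lf).
- by rewrite !uact1.
- by rewrite !uactD (linD lf) hs ht.
- by rewrite !uactZ (linZ lf) hs.
- by rewrite !uactM hs ht.
Qed.

Section Inverse.
Variables (A B : umodule V) (f : module_hom A B) (g : B -> A).
Hypotheses (fK : cancel f g) (gK : cancel g f).

Program Definition hom_inv : module_hom B A := @ModuleHom B A g _ _ _.
Next Obligation.
by move=> a x y; apply: (can_inj fK); rewrite gK (mhom_linear f) !gK.
Qed.
Next Obligation. by apply: (can_inj fK); rewrite gK mhom_even gK. Qed.
Next Obligation. by apply: (can_inj fK); rewrite gK mhom_uact gK. Qed.

End Inverse.

Section TensorHom.
Variables (A B A' B' : umodule V) (f : module_hom A A') (g : module_hom B B').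

Let tmap_fg_linear : linear (tmap f g).
Proof. by apply: tmap_linear; exact: mhom_linear. Qed.
Let tmap_fgE u w : tmap f g (tpure u w) = tpure (f u) (g w).
Proof. by apply: tmapE; exact: mhom_linear. Qed.

Lemma tens_hom_even p (z : tens_module A B) :
  tmap f g (proj p z) = proj p (tmap f g z : tens_module A' B').
Proof.
apply: (super_tens_ext (f := tmap f g \o @tproj K A B p)
  (g := @tproj K A' B' p \o tmap f g)) z.
- by apply: linear_comp => //; exact: tproj_linear.
- by apply: linear_comp => //; exact: tproj_linear.
move=> q r u w /=; rewrite tmap_fgE !mhom_even !tproj_hom.
case: eqP => _; last by rewrite (lin0 tmap_fg_linear).
by rewrite tmap_fgE !mhom_even.
Qed.

Lemma tens_hom_uact s (z : tens_module A B) :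
  tmap f g (uact _ s z) = uact (tens_module A' B') s (tmap f g z).
Proof.
apply: (@uact_gens (tens_module A B) (tens_module A' B')) => // p x.
apply: (super_tens_ext (f := tmap f g \o @tens_act K V A B p x)
  (g := @tens_act K V A' B' p x \o tmap f g)).
- by apply: linear_comp => //; exact: tens_act_linear.
- by apply: linear_comp => //; exact: tens_act_linear.
move=> q r u w /=; rewrite tmap_fgE mhom_even.
rewrite !(tens_act_hom _ _ (proj_id _ _)) (linD tmap_fg_linear) (linZ tmap_fg_linear).
by rewrite !tmap_fgE !mhom_uact mhom_even.
Qed.

Definition tens_hom : module_hom (tens_module A B) (tens_module A' B') :=
  @ModuleHom (tens_module A B) (tens_module A' B') (tmap f g)
    tmap_fg_linear tens_hom_even tens_hom_uact.

End TensorHom.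

Section Assoc.
Variables A B C : umodule V.

Definition assoc_fun : tens (tens A B) C -> tens A (tens B C) :=
  tlift (fun z c => tlift (fun a b => tpure a (tpure b c)) z).
Definition assoc_inv_fun : tens A (tens B C) -> tens (tens A B) C :=
  tlift (fun a z => tlift (fun b c => tpure (tpure a b) c) z).

Let bil (M N : lmodType K) := @tpure_bilin K M N.

Lemma assoc_bilin1 c : bilinear_map (fun (a : A) (b : B) => tpure a (tpure b (c : C))).
Proof.
split=> [b|a]; first exact: (proj1 (bil _ _)).
apply: (linear_comp (f := fun b => tpure b c)).
  exact: (proj1 (bil _ _)).
exact: (proj2 (bil _ _)).
Qed.

Lemma assoc_bilin2 a : bilinear_map (fun (b : B) (c : C) => tpure (tpure (a : A) b) c).
Proof.
split=> [c|b]; last exact: (proj2 (bil _ _)).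
apply: (linear_comp (f := fun b => tpure a b) (h := fun z => tpure z c)).
  exact: (proj2 (bil _ _)).
exact: (proj1 (bil _ _)).
Qed.

Lemma assoc_bilin : bilinear_map (fun (z : tens A B) (c : C) =>
  tlift (fun a b => tpure a (tpure b c)) z).
Proof.
split=> [c|z]; first by apply: tlift_linear; exact: assoc_bilin1.
apply: (@linear_big K _ _ _ _ (fun x c => tpure x.1 (tpure x.2 c))) => x.
apply: (linear_comp (f := fun c => tpure x.2 c)).
  exact: (proj2 (bil _ _)).
exact: (proj2 (bil _ _)).
Qed.

Lemma assoc_inv_bilin : bilinear_map (fun (a : A) (z : tens B C) =>
  tlift (fun b c => tpure (tpure a b) c) z).
Proof.
split=> [z|a]; last by apply: tlift_linear; exact: assoc_bilin2.
apply: (@linear_big K _ _ _ _ (fun x a => tpure (tpure a x.1) x.2)) => x.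
apply: (linear_comp (f := fun a => tpure a x.1) (h := fun z => tpure z x.2)).
  exact: (proj1 (bil _ _)).
exact: (proj1 (bil _ _)).
Qed.

Lemma assoc_linear : linear assoc_fun.
Proof. by apply: tlift_linear; exact: assoc_bilin. Qed.
Lemma assoc_inv_linear : linear assoc_inv_fun.
Proof. by apply: tlift_linear; exact: assoc_inv_bilin. Qed.
Lemma assocE a b c : assoc_fun (tpure (tpure a b) c) = tpure a (tpure b c).
Proof.
by rewrite /assoc_fun tlift_pure ?tlift_pure //; [exact: assoc_bilin1 | exact: assoc_bilin].
Qed.
Lemma assoc_invE a b c : assoc_inv_fun (tpure a (tpure b c)) = tpure (tpure a b) c.
Proof.
by rewrite /assoc_inv_fun tlift_pure ?tlift_pure //;
  [exact: assoc_bilin2 | exact: assoc_inv_bilin].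
Qed.

Lemma tens3_ext (P : lmodType K) (f g : tens (tens A B) C -> P) : linear f -> linear g ->
  (forall p q r a b c, f (tpure (tpure (proj p a) (proj q b)) (proj r c))
       = g (tpure (tpure (proj p a) (proj q b)) (proj r c))) -> f =1 g.
Proof.
move=> lf lg H; apply: (@super_tens_ext K (tens_super A B) C) => // s r z c.
have lc : linear (fun y : tens A B => tpure y (proj r c)) := proj1 (bil _ _) (proj r c).
apply: (super_tens_ext (f := f \o (fun y => tpure y (proj r c)))
  (g := g \o (fun y => tpure y (proj r c)))) => [|| p q a b].
- exact: (linear_comp lc lf).
- exact: (linear_comp lc lg).
by exact: H.
Qed.

Lemma assocK : cancel assoc_fun assoc_inv_fun.
Proof.
apply: (tens3_ext (f := assoc_inv_fun \o assoc_fun) (g := id)) => //.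
  by apply: linear_comp; [exact: assoc_linear | exact: assoc_inv_linear].
by move=> p q r a b c /=; rewrite assocE assoc_invE.
Qed.

Lemma assoc_invK : cancel assoc_inv_fun assoc_fun.
Proof.
apply: (tens_ext (f := assoc_fun \o assoc_inv_fun) (g := id)) => //.
  by apply: linear_comp; [exact: assoc_inv_linear | exact: assoc_linear].
move=> a; apply: (tens_ext (f := assoc_fun \o assoc_inv_fun \o tpure a) (g := tpure a)).
- apply: linear_comp; first exact: (proj2 (bil _ _)).
  by apply: linear_comp; [exact: assoc_inv_linear | exact: assoc_linear].
- exact: (proj2 (bil _ _)).
by move=> b c /=; rewrite assoc_invE assocE.
Qed.

Let AB_C := tens_module (tens_module A B) C.
Let A_BC := tens_module A (tens_module B C).

Lemma assoc_even p (z : AB_C) : assoc_fun (proj p z) = proj p (assoc_fun z : A_BC).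
Proof.
apply: (tens3_ext (f := assoc_fun \o @tproj K (tens_super A B) C p)
  (g := @tproj K A (tens_super B C) p \o assoc_fun)) z.
- exact: (linear_comp (@tproj_linear K (tens_super A B) C p) assoc_linear).
- exact: (linear_comp assoc_linear (@tproj_linear K A (tens_super B C) p)).
move=> q r s a b c /=; rewrite assocE.
have e1 : proj (q (+) r) (tpure (proj q a) (proj r b) : tens_super A B)
    = tpure (proj q a) (proj r b).
  by rewrite -[LHS]/(tproj _ _) tproj_hom eqxx.
have e2 : proj (r (+) s) (tpure (proj r b) (proj s c) : tens_super B C)
    = tpure (proj r b) (proj s c).
  by rewrite -[LHS]/(tproj _ _) tproj_hom eqxx.
rewrite -e1 -e2 !tproj_hom addbA e1 e2.
by case: eqP => _; rewrite ?assocE // (lin0 assoc_linear).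
Qed.

Lemma assoc_uact s (z : AB_C) : assoc_fun (uact _ s z) = uact A_BC s (assoc_fun z).
Proof.
apply: (@uact_gens AB_C A_BC); first exact: assoc_linear.
move=> p x; apply: (tens3_ext (f := assoc_fun \o @tens_act K V (tens_module A B) C p x)
  (g := @tens_act K V A (tens_module B C) p x \o assoc_fun)).
- exact: (linear_comp (@tens_act_linear K V (tens_module A B) C p x) assoc_linear).
- exact: (linear_comp assoc_linear (@tens_act_linear K V A (tens_module B C) p x)).
move=> q r t a b c /=; rewrite assocE.
have e1 : proj (q (+) r) (tpure (proj q a) (proj r b) : tens_super A B)
    = tpure (proj q a) (proj r b).
  by rewrite -[LHS]/(tproj _ _) tproj_hom eqxx.
rewrite (@tens_act_hom K V (tens_module A B) C p x (q (+) r)) //.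
rewrite (tens_act_hom (B := tens_module B C) _ _ (proj_id _ _)).
rewrite -![uact (tens_module _ _) (Ugen x) _]/(tens_act x _).
rewrite !(tens_act_hom _ _ (proj_id _ _)).
have [h1 h2] := bil (tens A B) C; have [h3 h4] := bil A (tens B C).
rewrite (linD (h1 _)) (linZ (h1 _)) (linD (h4 _)) (linZ (h4 _)).
rewrite !(linD assoc_linear) !(linZ assoc_linear) !assocE.
rewrite scalerDr scalerA addrA; congr (_ + _ *: _).
by clear; case: p; case: q; case: r; rewrite /= ?expr0 ?expr1 ?mulrNN ?mulr1 ?mul1r.
Qed.

Definition assoc_hom : module_hom AB_C A_BC :=
  @ModuleHom AB_C A_BC assoc_fun assoc_linear assoc_even assoc_uact.
Definition assoc_hom_inv : module_hom A_BC AB_C :=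
  @hom_inv AB_C A_BC assoc_hom assoc_inv_fun assocK assoc_invK.

End Assoc.

Section LeftUnit.
Variable A : umodule V.
Let CA := tens_module (ground_module V) A.

Definition unit_fun : tens K^o A -> A := tlift (fun (c : K^o) u => c *: u).

Lemma unit_bilin : bilinear_map (fun (c : K^o) (u : A) => c *: u).
Proof.
split=> [u a x y|c a x y]; first by rewrite scalerDl -scalerA.
by rewrite scalerDr !scalerA mulrC.
Qed.
Lemma unit_linear : linear unit_fun.
Proof. exact: tlift_linear unit_bilin. Qed.
Lemma unitE c u : unit_fun (tpure c u) = c *: u.
Proof. by rewrite /unit_fun tlift_pure //; exact: unit_bilin. Qed.

Lemma unitK : cancel unit_fun (fun u => tpure (1 : K^o) u).
Proof.
have [hl hr] := tpure_bilin K^o A.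
apply: (tens_ext (f := (fun u => tpure (1 : K^o) u) \o unit_fun) (g := id)) => //.
  by apply: linear_comp; [exact: unit_linear | exact: hr].
move=> c u /=; rewrite unitE (linZ (hr _)) -(linZ (hl u)).
by congr (tpure _ _); rewrite /GRing.scale /= mulr1.
Qed.
Lemma unit_invK : cancel (fun u => tpure (1 : K^o) u) unit_fun.
Proof. by move=> u; rewrite unitE scale1r. Qed.

Lemma unit_even p (z : CA) : unit_fun (proj p z) = proj p (unit_fun z).
Proof.
apply: (super_tens_ext (f := unit_fun \o @tproj K (ground_super K) A p)
  (g := @proj K A p \o unit_fun)) z.
- exact: (linear_comp (@tproj_linear K (ground_super K) A p) unit_linear).
- exact: (linear_comp unit_linear (@proj_linear K A p)).
move=> q r c u /=; rewrite unitE tproj_hom (linZ (proj_linear _)) proj_proj.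
case: q => /=; last by case: eqP => _; rewrite ?unitE // (lin0 unit_linear) scaler0.
have [hl _] := tpure_bilin K^o A.
by rewrite [proj true c](_ : _ = 0) // (lin0 (hl _)) if_same (lin0 unit_linear) scale0r.
Qed.

Lemma unit_uact s (z : CA) : unit_fun (uact _ s z) = uact A s (unit_fun z).
Proof.
apply: (@uact_gens CA A); first exact: unit_linear.
have [hl hr] := tpure_bilin K^o A.
move=> p x; apply: (super_tens_ext (f := unit_fun \o @tens_act K V (ground_module V) A p x)
  (g := uact A (Ugen x) \o unit_fun)).
- exact: (linear_comp (@tens_act_linear K V (ground_module V) A p x) unit_linear).
- exact: (linear_comp unit_linear (@uact_linear K V A _)).
move=> q r c u /=; rewrite unitE (tens_act_hom _ _ (proj_id _ _)).
rewrite [uact (ground_module V) _ _](_ : _ = 0) // (lin0 (hl _)) add0r.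
rewrite (linZ unit_linear) unitE (linZ (@uact_linear K V A _)).
case: q => /=; last by rewrite andbF scale1r.
by rewrite [proj true c](_ : _ = 0) // !scale0r scaler0.
Qed.

Definition unit_hom : module_hom CA A :=
  @ModuleHom CA A unit_fun unit_linear unit_even unit_uact.
Definition unit_hom_inv : module_hom A CA :=
  @hom_inv CA A unit_hom (fun u => tpure (1 : K^o) u) unitK unit_invK.

End LeftUnit.

Fixpoint tens_pow (r : nat) : umodule V :=
  if r is r'.+1 then tens_module (natural_module V) (tens_pow r')
  else ground_module V.

Fixpoint pow_join (r s : nat) :
  module_hom (tens_module (tens_pow r) (tens_pow s)) (tens_pow (r + s)) :=
  match r with
  | 0 => unit_hom (tens_pow s)
  | r'.+1 => hom_comp (tens_hom (hom_id (natural_module V)) (pow_join r' s))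
               (assoc_hom (natural_module V) (tens_pow r') (tens_pow s))
  end.

Fixpoint pow_split (r s : nat) :
  module_hom (tens_pow (r + s)) (tens_module (tens_pow r) (tens_pow s)) :=
  match r with
  | 0 => unit_hom_inv (tens_pow s)
  | r'.+1 => hom_comp (assoc_hom_inv (natural_module V) (tens_pow r') (tens_pow s))
               (tens_hom (hom_id (natural_module V)) (pow_split r' s))
  end.

Definition pole_pow (M : umodule V) (r : nat) : umodule V := tens_module M (tens_pow r).

Definition pole_join (M : umodule V) (r s : nat) :
  module_hom (tens_module (pole_pow M r) (tens_pow s)) (pole_pow M (r + s)) :=
  hom_comp (tens_hom (hom_id M) (pow_join r s)) (assoc_hom M (tens_pow r) (tens_pow s)).

Definition pole_split (M : umodule V) (r s : nat) :
  module_hom (pole_pow M (r + s)) (tens_module (pole_pow M r) (tens_pow s)) :=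
  hom_comp (assoc_hom_inv M (tens_pow r) (tens_pow s)) (tens_hom (hom_id M) (pow_split r s)).

Section TmapComp.
Variables (A B A' B' A'' B'' : umodule V).

Lemma tmap_comp (f : module_hom A A') (g : module_hom B B')
    (f' : module_hom A' A'') (g' : module_hom B' B'') z :
  tmap f' g' (tmap f g z) = tmap (f' \o f) (g' \o g) z.
Proof.
apply: (tens_ext (f := tmap f' g' \o tmap f g) (g := tmap (f' \o f) (g' \o g))) z.
- by apply: linear_comp; apply: tmap_linear; exact: mhom_linear.
- by apply: tmap_linear; apply: linear_comp; exact: mhom_linear.
move=> u w /=; rewrite !tmapE //; try exact: mhom_linear.
- by apply: linear_comp; exact: mhom_linear.
- by apply: linear_comp; exact: mhom_linear.
Qed.

Lemma eq_tmap (f f' : A -> A') (g g' : B -> B') : f =1 f' -> g =1 g' ->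
  tmap f g =1 tmap f' g'.
Proof. by move=> /funext -> /funext ->. Qed.

Lemma tmap_id (z : tens A B) : tmap id id z = z.
Proof.
apply: (tens_ext (f := tmap id id) (g := id)) z => //; first exact: tmap_linear.
by move=> u w; rewrite tmapE.
Qed.

End TmapComp.

Lemma pow_joinK r s : cancel (pow_join r s) (pow_split r s).
Proof.
elim: r => [|r IH] z; first exact: unitK.
pose i := hom_id (natural_module V).
have E y : tens_hom i (pow_split r s) (tens_hom i (pow_join r s) y) = y.
  rewrite -[RHS]tmap_id; apply: (etrans (tmap_comp i (pow_join r s) i (pow_split r s) y)); exact: eq_tmap.
exact: (etrans (congr1 (assoc_hom_inv _ _ _) (E (assoc_hom _ _ _ z))) (assocK z)).
Qed.

Lemma pow_splitK r s : cancel (pow_split r s) (pow_join r s).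
Proof.
elim: r => [|r IH] z; first exact: unit_invK.
pose i := hom_id (natural_module V).
have E y : tens_hom i (pow_join r s) (tens_hom i (pow_split r s) y) = y.
  rewrite -[RHS]tmap_id; apply: (etrans (tmap_comp i (pow_split r s) i (pow_join r s) y)); exact: eq_tmap.
exact: (etrans (congr1 (tens_hom i (pow_join r s)) (assoc_invK _)) (E z)).
Qed.

Lemma pole_joinK M r s : cancel (pole_join M r s) (pole_split M r s).
Proof.
move=> z; pose i := hom_id M.
have E y : tens_hom i (pow_split r s) (tens_hom i (pow_join r s) y) = y.
  rewrite -[RHS]tmap_id; apply: (etrans (tmap_comp i (pow_join r s) i (pow_split r s) y)); apply: eq_tmap => //; exact: pow_joinK.
exact: (etrans (congr1 (assoc_hom_inv _ _ _) (E (assoc_hom _ _ _ z))) (assocK z)).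
Qed.

Lemma pole_splitK M r s : cancel (pole_split M r s) (pole_join M r s).
Proof.
move=> z; pose i := hom_id M.
have E y : tens_hom i (pow_join r s) (tens_hom i (pow_split r s) y) = y.
  rewrite -[RHS]tmap_id; apply: (etrans (tmap_comp i (pow_split r s) i (pow_join r s) y)); apply: eq_tmap => //; exact: pow_splitK.
exact: (etrans (congr1 (tens_hom i (pow_join r s)) (assoc_invK _)) (E z)).
Qed.

End Homs.

(* Morphisms are compared by an equivalence [heq], so that hom-sets may be
   presented as quotients. *)
Record category := Category {
  ob :> Type;
  hom : ob -> ob -> Type;
  heq : forall x y, hom x y -> hom x y -> Prop;
  cid : forall x, hom x x;
  cmp : forall x y z, hom y z -> hom x y -> hom x z;
  heq_refl : forall x y (f : hom x y), heq f f;
  heq_sym : forall x y (f g : hom x y), heq f g -> heq g f;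
  heq_trans : forall x y (f g h : hom x y), heq f g -> heq g h -> heq f h;
  cmp_heq : forall x y z (g g' : hom y z) (f f' : hom x y),
    heq g g' -> heq f f' -> heq (cmp g f) (cmp g' f');
  cmpA : forall x y z w (h : hom z w) (g : hom y z) (f : hom x y),
    heq (cmp h (cmp g f)) (cmp (cmp h g) f);
  cmp1l : forall x y (f : hom x y), heq (cmp (cid y) f) f;
  cmp1r : forall x y (f : hom x y), heq (cmp f (cid x)) f }.

Record functor (C D : category) (o : C -> D) := Functor {
  fmap : forall x y : C, hom x y -> hom (o x) (o y);
  fmap_heq : forall (x y : C) (f g : hom x y), heq f g -> heq (fmap f) (fmap g);
  fmap_id : forall x : C, heq (fmap (cid x)) (cid (o x));
  fmap_cmp : forall (x y z : C) (g : hom y z) (f : hom x y),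
    heq (fmap (cmp g f)) (cmp (fmap g) (fmap f)) }.

Definition functor_eq (C D : category) (o : C -> D) (F G : functor o) : Prop :=
  forall (x y : C) (f : hom x y), heq (fmap F f) (fmap G f).

Program Definition functor_comp (C D E : category) (p : D -> E) (o : C -> D)
    (G : functor p) (F : functor o) : @functor C E (fun x => p (o x)) :=
  @Functor C E _ (fun x y f => fmap G (fmap F f)) _ _ _.
Next Obligation. by apply: fmap_heq; exact: fmap_heq. Qed.
Next Obligation.
by apply: heq_trans; [apply: fmap_heq; exact: fmap_id | exact: fmap_id].
Qed.
Next Obligation.
by apply: heq_trans; [apply: fmap_heq; exact: fmap_cmp | exact: fmap_cmp].
Qed.

Program Definition prod_category (C D : category) : category :=
  @Category (C * D)%type (fun x y => (hom x.1 y.1 * hom x.2 y.2)%type)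
    (fun x y f g => heq f.1 g.1 /\ heq f.2 g.2)
    (fun x => (cid x.1, cid x.2))
    (fun x y z g f => (cmp g.1 f.1, cmp g.2 f.2)) _ _ _ _ _ _ _.
Next Obligation. by split; exact: heq_refl. Qed.
Next Obligation. by split; exact: heq_sym. Qed.
Next Obligation. by split; apply: heq_trans; eassumption. Qed.
Next Obligation. by split; exact: cmp_heq. Qed.
Next Obligation. by split; exact: cmpA. Qed.
Next Obligation. by split; exact: cmp1l. Qed.
Next Obligation. by split; exact: cmp1r. Qed.

Program Definition functor_prod (C C' D D' : category) (o : C -> D) (o' : C' -> D')
    (F : functor o) (G : functor o') :
    @functor (prod_category C C') (prod_category D D') (fun x => (o x.1, o' x.2)) :=
  @Functor (prod_category C C') (prod_category D D') _
    (fun x y f => (fmap F f.1, fmap G f.2)) _ _ _.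
Next Obligation. by split; exact: fmap_heq. Qed.
Next Obligation. by split; exact: fmap_id. Qed.
Next Obligation. by split; exact: fmap_cmp. Qed.

Definition full_subcategory (C : category) (I : Type) (j : I -> C) : category :=
  @Category I (fun x y => hom (j x) (j y)) (fun x y f g => heq f g)
    (fun x => cid (j x)) (fun x y z g f => cmp g f)
    (fun _ _ => @heq_refl C _ _) (fun _ _ => @heq_sym C _ _)
    (fun _ _ => @heq_trans C _ _) (fun _ _ _ => @cmp_heq C _ _ _)
    (fun _ _ _ _ => @cmpA C _ _ _ _) (fun _ _ => @cmp1l C _ _)
    (fun _ _ => @cmp1r C _ _).

Section ModuleCategories.
Variables (K : fieldType) (V : ortho_space K).

Program Definition module_category : category :=
  @Category (umodule V) (@module_hom K V) (fun A B f g => f =1 g)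
    (@hom_id K V) (@hom_comp K V) _ _ _ _ _ _ _.
Next Obligation. by move=> u; rewrite H. Qed.
Next Obligation. by move=> u; rewrite H H0. Qed.
Next Obligation. by move=> u; rewrite /= H0 H. Qed.

Definition hom_cast (A A' B B' : umodule V) (eA : A = A') (eB : B = B')
    (f : module_hom A B) : module_hom A' B' :=
  eq_rect B (module_hom A') (eq_rect A (fun C => module_hom C B) f A' eA) B' eB.

Lemma hom_cast_eq A A' B B' (eA : A = A') (eB : B = B') (f g : module_hom A B) :
  f =1 g -> hom_cast eA eB f =1 hom_cast eA eB g.
Proof. by case: A' / eA; case: B' / eB. Qed.

Lemma hom_cast_id A A' (eA : A = A') : hom_cast eA eA (hom_id A) = hom_id A'.
Proof. by case: A' / eA. Qed.

Lemma hom_cast_comp A A' B B' C C' (eA : A = A') (eB : B = B') (eC : C = C')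
    (g : module_hom B C) (f : module_hom A B) :
  hom_cast eA eC (hom_comp g f) = hom_comp (hom_cast eB eC g) (hom_cast eA eB f).
Proof. by case: A' / eA; case: B' / eB; case: C' / eC. Qed.

(* T(V) and T_M(V), with r standing for V^(tensor r), resp. M (x) V^(tensor r). *)
Definition T_cat : category := full_subcategory (C := module_category) (@tens_pow K V).
Definition TM_cat (M : umodule V) : category :=
  full_subcategory (C := module_category) (pole_pow M).

(* (M (x) V^r) (x) V^s is identified with M (x) V^(r + s). *)

#[local] Obligation Tactic := idtac.
Program Definition TM_tensor (M : umodule V) :
    @functor (prod_category (TM_cat M) T_cat) (TM_cat M) (fun x => (x.1 + x.2)%N) :=
  @Functor (prod_category (TM_cat M) T_cat) (TM_cat M) _
    (fun x y f => hom_comp (pole_join M y.1 y.2)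
       (hom_comp (tens_hom f.1 f.2) (pole_split M x.1 x.2))) _ _ _.
Next Obligation.
move=> M [r s] [r' s'] [f f'] [g g'] /= [/= H H'] u /=.
apply: (congr1 (pole_join M r' s')).
exact: (@eq_tmap K V (pole_pow M r) (tens_pow V s) (pole_pow M r') (tens_pow V s')).
Qed.
Next Obligation.
move=> M [r s] u.
apply: (etrans (congr1 (pole_join M r s) (@tmap_id K V (pole_pow M r) (tens_pow V s) _))); exact: pole_splitK.
Qed.
Next Obligation.
move=> M [r s] [r' s'] [r'' s''] [g g'] [f f'] u.
apply: (congr1 (pole_join M r'' s'')).
apply: (etrans (esym (tmap_comp f f' g g' _))).
by apply: (congr1 (tmap g g')); apply: esym; exact: pole_joinK.
Qed.

End ModuleCategories.

(* The letters m and v. *)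
Inductive letter := Lm | Lv.

Definition letter_isv (a : letter) : bool := if a is Lv then true else false.
Definition letter_of (b : bool) : letter := if b then Lv else Lm.
Lemma letter_isvK : cancel letter_isv letter_of. Proof. by case. Qed.
HB.instance Definition _ := Equality.copy letter (can_type letter_isvK).

Definition word := seq letter.

(* The points of a diagram from s to t: [inl] is the bottom row. *)
Definition point (s t : word) : Type := ('I_(size s) + 'I_(size t))%type.

Definition point_letter (s t : word) (x : point s t) : letter :=
  match x with inl i => nth Lv s i | inr j => nth Lv t j end.

Definition is_bottom (s t : word) (x : point s t) : bool :=
  if x is inl _ then true else false.

Definition is_matching (s t : word) (D : {ffun point s t -> point s t}) : bool :=
  [forall x, [&& D (D x) == x, D x != x, point_letter (D x) == point_letter x &
    (is_bottom (D x) == is_bottom x) ==> (point_letter x == Lv)]].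

(* [D x] is the point matched with x. *)
Record diagram (s t : word) := Diagram {
  partner :> {ffun point s t -> point s t};
  partnerP : is_matching partner }.

Section Stacking.
Variables (s t u : word).

Definition stack_point : Type := (('I_(size s) + 'I_(size t)) + 'I_(size u))%type.

Definition lower_point (x : point s t) : stack_point := inl x.
Definition upper_point (x : point t u) : stack_point :=
  match x with inl j => inl (inr j) | inr k => inr k end.
Definition outer_point (x : point s u) : stack_point :=
  match x with inl i => inl (inl i) | inr k => inr k end.

Variables (B : diagram t u) (A : diagram s t).

Definition stack_edge (x y : stack_point) : bool :=
  [exists p, (x == lower_point p) && (y == lower_point (A p))]
  || [exists p, (x == upper_point p) && (y == upper_point (B p))].

Definition closed_loops : nat :=
  #|[set S in [set [set y | connect stack_edge x y] | x : stack_point] |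
      [forall p, outer_point p \notin S]]|.

(* Stacking B on top of A gives the diagram D together with k closed loops.  Every
   component of the stacked graph has either two outer points or none, so D and k
   exist and are unique. *)
Definition stacks (D : diagram s u) (k : nat) : Prop :=
  (forall p, connect stack_edge (outer_point p) (outer_point (D p))) /\ k = closed_loops.

End Stacking.

Definition lshift_word (s s' : word) (i : 'I_(size s)) : 'I_(size (s ++ s')) :=
  cast_ord (esym (size_cat s s')) (lshift (size s') i).
Definition rshift_word (s s' : word) (i : 'I_(size s')) : 'I_(size (s ++ s')) :=
  cast_ord (esym (size_cat s s')) (rshift (size s) i).
Definition split_word (s s' : word) (i : 'I_(size (s ++ s'))) : 'I_(size s) + 'I_(size s') :=
  split (cast_ord (size_cat s s') i).

Section Juxtaposition.
Variables (s t s' t' : word).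

Definition left_point (x : point s t) : point (s ++ s') (t ++ t') :=
  match x with inl i => inl (lshift_word s' i) | inr j => inr (lshift_word t' j) end.
Definition right_point (x : point s' t') : point (s ++ s') (t ++ t') :=
  match x with inl i => inl (rshift_word s i) | inr j => inr (rshift_word t j) end.

Definition juxtaposes (A : diagram s t) (B : diagram s' t')
    (D : diagram (s ++ s') (t ++ t')) : Prop :=
  (forall x, D (left_point x) = left_point (A x))
  /\ (forall x, D (right_point x) = right_point (B x)).

End Juxtaposition.

Section Bijective.
Variables (s t : word) (f : 'I_(size s) -> 'I_(size t)) (g : 'I_(size t) -> 'I_(size s)).
Hypotheses (fK : cancel f g) (gK : cancel g f).
Hypothesis fl : forall i, nth Lv t (f i) = nth Lv s i.

Definition bij_partner : {ffun point s t -> point s t} :=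
  [ffun x => match x with inl i => inr (f i) | inr j => inl (g j) end].

Lemma bij_partnerP : is_matching bij_partner.
Proof.
apply/forallP => -[i|j]; rewrite !ffunE /= ?ffunE ?fK ?gK ?fl !eqxx //=.
by rewrite -fl gK eqxx.
Qed.

Definition bij_diagram : diagram s t := Diagram bij_partnerP.
End Bijective.

Definition id_diagram (s : word) : diagram s s :=
  @bij_diagram s s id id (fun _ => erefl) (fun _ => erefl) (fun _ => erefl).

Definition cross_fun (s t : word) (i : 'I_(size (s ++ t))) : 'I_(size (t ++ s)) :=
  match split_word i with
  | inl j => rshift_word t j
  | inr j => lshift_word s j
  end.

Lemma split_wordK s t (i : 'I_(size (s ++ t))) :
  match split_word i with inl j => lshift_word t j | inr j => rshift_word s j end = i.
Proof.
apply: val_inj; rewrite /split_word; case: splitP => j /= -> //.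
Qed.

Lemma split_lshift s t (j : 'I_(size s)) : split_word (lshift_word t j) = inl j.
Proof. by rewrite /split_word cast_ordKV; exact: (unsplitK (inl j)). Qed.
Lemma split_rshift s t (j : 'I_(size t)) : split_word (rshift_word s j) = inr j.
Proof. by rewrite /split_word cast_ordKV; exact: (unsplitK (inr j)). Qed.

Lemma cross_funK s t : cancel (@cross_fun s t) (@cross_fun t s).
Proof.
move=> i; rewrite -[RHS]split_wordK /cross_fun.
by case: (split_word i) => j; rewrite ?split_lshift ?split_rshift.
Qed.

Lemma cross_fun_letter s t (i : 'I_(size (s ++ t))) :
  nth Lv (t ++ s) (cross_fun i) = nth Lv (s ++ t) i.
Proof.
rewrite -[in RHS](split_wordK i) /cross_fun; case: (split_word i) => j /=.
  by rewrite !nth_cat ltn_ord ltnNge leq_addr /= addKn.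
by rewrite !nth_cat ltn_ord ltnNge leq_addr /= addKn.
Qed.

Definition cross_diagram (s t : word) : diagram (s ++ t) (t ++ s) :=
  bij_diagram (@cross_funK s t) (@cross_funK t s) (@cross_fun_letter s t).

Definition cup_partner : {ffun point [::] [:: Lv; Lv] -> point [::] [:: Lv; Lv]} :=
  [ffun x => match x with inl i => inl i | inr j => inr (rev_ord j) end].
Lemma cup_partnerP : is_matching cup_partner.
Proof. by apply/forallP => -[[]|[[|[|]] ?]] //; rewrite !ffunE /= ?ffunE //=; rewrite ?rev_ordK. Qed.
Definition cup_diagram : diagram [::] [:: Lv; Lv] := Diagram cup_partnerP.

Definition cap_partner : {ffun point [:: Lv; Lv] [::] -> point [:: Lv; Lv] [::]} :=
  [ffun x => match x with inl i => inl (rev_ord i) | inr j => inr j end].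
Lemma cap_partnerP : is_matching cap_partner.
Proof. by apply/forallP => -[[[|[|]] ?]|[]] //; rewrite !ffunE /= ?ffunE //=; rewrite ?rev_ordK. Qed.
Definition cap_diagram : diagram [:: Lv; Lv] [::] := Diagram cap_partnerP.

Section MPB.
Variables (K : fieldType) (delta : K).

(* [HH a b] is the adjoined morphism H(a, b). *)
Inductive mor : word -> word -> Type :=
| Diag s t of diagram s t : mor s t
| HH a b : mor [:: a; b] [:: a; b]
| Zero s t : mor s t
| Add s t of mor s t & mor s t : mor s t
| Scale s t of K & mor s t : mor s t
| Comp s t u of mor t u & mor s t : mor s u
| Tens s t s' t' of mor s t & mor s' t' : mor (s ++ s') (t ++ t').

Definition mor_cast s s' t t' (es : s = s') (et : t = t') (f : mor s t) : mor s' t' :=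
  eq_rect t (mor s') (eq_rect s (mor^~ t) f s' es) t' et.

Definition Id (s : word) : mor s s := Diag (id_diagram s).
Definition XX (s t : word) : mor (s ++ t) (t ++ s) := Diag (cross_diagram s t).
Definition Cup : mor [::] [:: Lv; Lv] := Diag cup_diagram.
Definition Cap : mor [:: Lv; Lv] [::] := Diag cap_diagram.
Definition EE : mor [:: Lv; Lv] [:: Lv; Lv] := Comp Cup Cap.

Definition Sub s t (f g : mor s t) : mor s t := Add f (Scale (-1) g).
Definition Commutator s (f g : mor s s) : mor s s := Sub (Comp f g) (Comp g f).

Definition H12 a b c : mor [:: a; b; c] [:: a; b; c] := Tens (HH a b) (Id [:: c]).
Definition H23 a b c : mor [:: a; b; c] [:: a; b; c] := Tens (Id [:: a]) (HH b c).
Definition H13 a b c : mor [:: a; b; c] [:: a; b; c] :=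
  Comp (Tens (Id [:: a]) (XX [:: c] [:: b]))
    (Comp (Tens (HH a c) (Id [:: b])) (Tens (Id [:: a]) (XX [:: b] [:: c]))).

(* The smallest K-linear strict monoidal congruence that contains the composition
   and tensor product of diagrams, the sliding, symmetry, skewness and four-term
   relations for [HH], and HH(v, v) = X - E.  Hom(s, t) in MPB(delta) is [mor s t]
   modulo [mpb_eq]. *)
Inductive mpb_eq : forall s t, mor s t -> mor s t -> Prop :=
| mpb_refl s t (f : mor s t) : mpb_eq f f
| mpb_sym s t (f g : mor s t) : mpb_eq f g -> mpb_eq g f
| mpb_trans s t (f g h : mor s t) : mpb_eq f g -> mpb_eq g h -> mpb_eq f h
| mpb_add s t (f f' g g' : mor s t) :
    mpb_eq f f' -> mpb_eq g g' -> mpb_eq (Add f g) (Add f' g')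
| mpb_scale s t a (f f' : mor s t) : mpb_eq f f' -> mpb_eq (Scale a f) (Scale a f')
| mpb_comp s t u (g g' : mor t u) (f f' : mor s t) :
    mpb_eq g g' -> mpb_eq f f' -> mpb_eq (Comp g f) (Comp g' f')
| mpb_tens s t s' t' (f g : mor s t) (f' g' : mor s' t') :
    mpb_eq f g -> mpb_eq f' g' -> mpb_eq (Tens f f') (Tens g g')
| mpb_addA s t (f g h : mor s t) : mpb_eq (Add f (Add g h)) (Add (Add f g) h)
| mpb_addC s t (f g : mor s t) : mpb_eq (Add f g) (Add g f)
| mpb_add0 s t (f : mor s t) : mpb_eq (Add (Zero s t) f) f
| mpb_scale0 s t (f : mor s t) : mpb_eq (Scale 0 f) (Zero s t)
| mpb_scale1 s t (f : mor s t) : mpb_eq (Scale 1 f) f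
| mpb_scaleA s t a b (f : mor s t) : mpb_eq (Scale a (Scale b f)) (Scale (a * b) f)
| mpb_scaleDl s t a b (f : mor s t) :
    mpb_eq (Scale (a + b) f) (Add (Scale a f) (Scale b f))
| mpb_scaleDr s t a (f g : mor s t) :
    mpb_eq (Scale a (Add f g)) (Add (Scale a f) (Scale a g))
| mpb_compDl s t u (g g' : mor t u) (f : mor s t) :
    mpb_eq (Comp (Add g g') f) (Add (Comp g f) (Comp g' f))
| mpb_compDr s t u (g : mor t u) (f f' : mor s t) :
    mpb_eq (Comp g (Add f f')) (Add (Comp g f) (Comp g f'))
| mpb_compZl s t u a (g : mor t u) (f : mor s t) :
    mpb_eq (Comp (Scale a g) f) (Scale a (Comp g f))
| mpb_compZr s t u a (g : mor t u) (f : mor s t) :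
    mpb_eq (Comp g (Scale a f)) (Scale a (Comp g f))
| mpb_tensDl s t s' t' (f g : mor s t) (h : mor s' t') :
    mpb_eq (Tens (Add f g) h) (Add (Tens f h) (Tens g h))
| mpb_tensDr s t s' t' (f : mor s t) (g h : mor s' t') :
    mpb_eq (Tens f (Add g h)) (Add (Tens f g) (Tens f h))
| mpb_tensZl s t s' t' a (f : mor s t) (h : mor s' t') :
    mpb_eq (Tens (Scale a f) h) (Scale a (Tens f h))
| mpb_tensZr s t s' t' a (f : mor s t) (h : mor s' t') :
    mpb_eq (Tens f (Scale a h)) (Scale a (Tens f h))
| mpb_compA s t u w (h : mor u w) (g : mor t u) (f : mor s t) :
    mpb_eq (Comp h (Comp g f)) (Comp (Comp h g) f)
| mpb_comp1l s t (f : mor s t) : mpb_eq (Comp (Id t) f) f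
| mpb_comp1r s t (f : mor s t) : mpb_eq (Comp f (Id s)) f
| mpb_tensA s t s' t' s'' t'' (f : mor s t) (g : mor s' t') (h : mor s'' t'') :
    mpb_eq (mor_cast (catA s s' s'') (catA t t' t'') (Tens f (Tens g h)))
      (Tens (Tens f g) h)
| mpb_tens1l s t (f : mor s t) : mpb_eq (Tens (Id [::]) f) f
| mpb_tens1r s t (f : mor s t) :
    mpb_eq (mor_cast (cats0 s) (cats0 t) (Tens f (Id [::]))) f
| mpb_interchange s t u s' t' u' (g : mor t u) (f : mor s t) (g' : mor t' u') (f' : mor s' t') :
    mpb_eq (Comp (Tens g g') (Tens f f')) (Tens (Comp g f) (Comp g' f'))
| mpb_stack s t u (B : diagram t u) (A : diagram s t) (D : diagram s u) k :
    stacks B A D k -> mpb_eq (Comp (Diag B) (Diag A)) (Scale (delta ^+ k) (Diag D))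
| mpb_juxtapose s t s' t' (A : diagram s t) (B : diagram s' t') D :
    juxtaposes A B D -> mpb_eq (Tens (Diag A) (Diag B)) (Diag D)
| mpb_slide_l w a b :
    mpb_eq (Comp (XX w [:: a; b]) (Tens (Id w) (HH a b)))
      (Comp (Tens (HH a b) (Id w)) (XX w [:: a; b]))
| mpb_slide_r w a b :
    mpb_eq (Comp (XX [:: a; b] w) (Tens (HH a b) (Id w)))
      (Comp (Tens (Id w) (HH a b)) (XX [:: a; b] w))
| mpb_sym_H a b :
    mpb_eq (Comp (XX [:: b] [:: a]) (HH b a)) (Comp (HH a b) (XX [:: b] [:: a]))
| mpb_skew_l a :
    mpb_eq
      (Comp (Tens (Id [:: Lv]) (Tens Cap (Id [:: a])))
        (Comp (Tens (XX [:: Lv] [:: Lv]) (HH Lv a))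
          (Tens (Id [:: Lv]) (Tens Cup (Id [:: a])))))
      (Scale (-1) (HH Lv a))
| mpb_skew_r a :
    mpb_eq
      (Comp (Tens (Id [:: a]) (Tens Cap (Id [:: Lv])))
        (Comp (Tens (HH a Lv) (XX [:: Lv] [:: Lv]))
          (Tens (Id [:: a]) (Tens Cup (Id [:: Lv])))))
      (Scale (-1) (HH a Lv))
| mpb_four_l a b c :
    mpb_eq (Commutator (H12 a b c) (Add (H13 a b c) (H23 a b c))) (Zero _ _)
| mpb_four_r a b c :
    mpb_eq (Commutator (Add (H12 a b c) (H13 a b c)) (H23 a b c)) (Zero _ _)
| mpb_HH_vv : mpb_eq (HH Lv Lv) (Sub (XX [:: Lv] [:: Lv]) EE).

Definition MPB : category :=
  @Category word mor mpb_eq Id Comp mpb_refl mpb_sym mpb_trans mpb_comp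
    mpb_compA mpb_comp1l mpb_comp1r.

Definition strands (r : nat) : word := nseq r Lv.
Definition polar (r : nat) : word := Lm :: strands r.

Definition Brauer : category := full_subcategory (C := MPB) strands.
Definition PB : category := full_subcategory (C := MPB) polar.

Lemma cat_strands r s : strands r ++ strands s = strands (r + s).
Proof. by rewrite /strands nseqD. Qed.
Lemma cat_polar r s : polar r ++ strands s = polar (r + s).
Proof. by rewrite /= cat_strands. Qed.

Lemma mpb_cast s s' t t' (es : s = s') (et : t = t') (f g : mor s t) :
  mpb_eq f g -> mpb_eq (mor_cast es et f) (mor_cast es et g).
Proof. by case: s' / es; case: t' / et. Qed.

Lemma mor_cast_Comp s s' t t' u u' (es : s = s') (et : t = t') (eu : u = u')
    (g : mor t u) (f : mor s t) :
  mor_cast es eu (Comp g f) = Comp (mor_cast et eu g) (mor_cast es et f).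
Proof. by case: s' / es; case: t' / et; case: u' / eu. Qed.

Lemma mor_cast_Id s s' (es : s = s') : mor_cast es es (Id s) = Id s'.
Proof. by case: s' / es. Qed.

Lemma mpb_tens_Id s t : mpb_eq (Tens (Id s) (Id t)) (Id (s ++ t)).
Proof. by apply: mpb_juxtapose; split=> -[i|i]; rewrite !ffunE. Qed.

Definition PB_tensor_hom (r r' s s' : nat) (f : mor (polar r) (polar r'))
    (g : mor (strands s) (strands s')) : mor (polar (r + s)) (polar (r' + s')) :=
  mor_cast (cat_polar r s) (cat_polar r' s') (Tens f g).

Definition Brauer_tensor_hom (r r' s s' : nat) (f : mor (strands r) (strands r'))
    (g : mor (strands s) (strands s')) : mor (strands (r + s)) (strands (r' + s')) :=
  mor_cast (cat_strands r s) (cat_strands r' s') (Tens f g).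

#[local] Obligation Tactic := idtac.
Program Definition PB_tensor :
    @functor (prod_category PB Brauer) PB (fun x => (x.1 + x.2)%N) :=
  @Functor (prod_category PB Brauer) PB _
    (fun x y f => PB_tensor_hom f.1 f.2) _ _ _.
Next Obligation.
move=> x y f g H; exact: (mpb_cast _ _ (mpb_tens H.1 H.2)).
Qed.
Next Obligation.
move=> x; apply: mpb_trans; first by apply: mpb_cast; exact: mpb_tens_Id.
by rewrite mor_cast_Id; exact: mpb_refl.
Qed.
Next Obligation.
move=> x y z g f; rewrite [cmp _ _]/= /PB_tensor_hom.
apply: mpb_trans.
  by apply: mpb_cast; apply: mpb_sym; exact: mpb_interchange.
by rewrite (mor_cast_Comp _ (cat_polar y.1 y.2)); exact: mpb_refl.
Qed.

End MPB.

Arguments HH {K} a b.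
Arguments XX {K} s t.
Arguments Cup {K}.
Arguments Cap {K}.
Arguments Id {K} s.

Section Functors.
Variables (K : fieldType) (V : ortho_space K).

Record homogeneous_basis := HomogeneousBasis {
  bsize : nat;
  basis :> bsize.-tuple V;
  basisP : basis_of fullv basis;
  bparity : 'I_bsize -> bool;
  bparityP : forall a, oproj (bparity a) (tnth basis a) = tnth basis a }.

Variable e : homogeneous_basis.
Local Notation n := (bsize e).
Local Notation "'[ a ]" := (bparity a) (format "''[' a ]").

Definition gram : 'M[K]_n := \matrix_(a, b) omega (tnth e a) (tnth e b).
Definition gram_inv : 'M[K]_n := invmx gram.

(* E^c_b (e^a) = delta^a_b e^c *)
Definition E_fun (c b : 'I_n) (v : V) : V := coord e b v *: tnth e c.
Lemma E_fun_linear c b : linear (E_fun c b).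
Proof. by move=> a u v; rewrite /E_fun linearP scalerDl scalerA. Qed.
HB.instance Definition _ c b :=
  GRing.isLinear.Build K V V *:%R (E_fun c b) (E_fun_linear c b).
Definition matrix_unit (c b : 'I_n) : 'End(V) := linfun (E_fun c b).

Lemma matrix_unitE c b v : matrix_unit c b v = coord e b v *: tnth e c.
Proof. by rewrite /matrix_unit lfunE. Qed.

Definition X_end (a b : 'I_n) : 'End(V) :=
  matrix_unit a b - (-1) ^+ ('[a] && '[b]) *:
    \sum_(a' < n) \sum_(b' < n) (gram a a' * gram_inv b b') *: matrix_unit b' a'.

Definition dual_basis (a : 'I_n) : V := \sum_b gram_inv a b *: tnth e b.

Lemma e_nth (a : 'I_n) : e`_a = tnth e a.
Proof. by rewrite (tnth_nth 0). Qed.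

Lemma basis_coord v : v = \sum_a coord e a v *: tnth e a.
Proof.
rewrite {1}(coord_basis (basisP e) (memvf v)).
by apply: eq_bigr => a _; rewrite e_nth.
Qed.

Lemma coord_tnth a b : coord e a (tnth e b) = (a == b)%:R.
Proof. have fe := basis_free (basisP e). by rewrite -e_nth coord_free // eq_sym. Qed.

Lemma basis_ext (W : lmodType K) (f g : V -> W) : linear f -> linear g ->
  (forall a, f (tnth e a) = g (tnth e a)) -> f =1 g.
Proof.
move=> lf lg H v; rewrite (basis_coord v) (linS lf) (linS lg).
by apply: eq_bigr => a _; rewrite (linZ lf) (linZ lg) H.
Qed.

Let om_linear_l (w : V) : linear (fun u => omega u w : K^o) := @omega_linear_l K V w.
Let om_linear_r (u : V) : linear (omega u : V -> K^o) := @omega_linear_r K V u.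

Lemma gram_unit : gram \in unitmx.
Proof.
rewrite -row_free_unit; apply: inj_row_free => v hv.
pose u : V := \sum_a v 0 a *: tnth e a.
have u0 : u = 0.
  apply: omega_nondeg; apply: (@basis_ext K^o (omega u) (fun=> 0)) => [||b].
  - exact: om_linear_r.
  - exact: linear_zero.
  rewrite /u (linS (om_linear_l _)).
  move/rowP/(_ b): hv; rewrite !mxE => hv; rewrite -[RHS]hv.
  by apply: eq_bigr => a _; rewrite (linZ (om_linear_l _)) mxE.
apply/rowP => b; rewrite mxE -[LHS]mul1r.
have : coord e b u = 0 by rewrite u0 linear0.
rewrite /u linear_sum (bigD1 b) //= big1 ?addr0 => [|a /negbTE ab].
  by rewrite linearZ /= coord_tnth eqxx mulr1 mul1r.
by rewrite linearZ /= coord_tnth eq_sym ab mulr0.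
Qed.

Lemma gram_even a b : '[a] != '[b] -> gram a b = 0.
Proof.
rewrite mxE -(bparityP a) -(bparityP b).
have := omega_even (tnth e a) (tnth e b).
by case: '[a]; case: '[b] => // -[].
Qed.

Lemma gram_supersym a b : gram a b = (-1) ^+ ('[a] && '[b]) * gram b a.
Proof. by rewrite !mxE -(bparityP a) -(bparityP b) -omega_supersym. Qed.

Lemma gram_inv_even a b : '[a] != '[b] -> gram_inv a b = 0.
Proof.
move=> ab; pose P : 'M[K]_n := diag_mx (\row_c ('[c])%:R).
have PG : P *m gram = gram *m P.
  apply/matrixP => c d; rewrite mul_diag_mx mul_mx_diag mxE [RHS]mxE !mxE.
  have [cd|/gram_even] := eqVneq '[c] '[d]; first by rewrite cd mulrC.
  by rewrite mxE => ->; rewrite mulr0 mul0r.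
have : P *m gram_inv = gram_inv *m P.
  rewrite -[LHS](mul1mx) -(mulVmx gram_unit) -!mulmxA [gram *m _]mulmxA -PG.
  by rewrite -mulmxA mulmxV ?gram_unit // mulmx1.
move/matrixP/(_ a b); rewrite mul_diag_mx mul_mx_diag [LHS]mxE [RHS]mxE !mxE.
by move: ab; case: '[a]; case: '[b] => //= _; rewrite ?mulr0 ?mul0r ?mul1r ?mulr1 // => ->.
Qed.

Lemma dual_basisP a b : omega (dual_basis a) (tnth e b) = (a == b)%:R.
Proof.
rewrite /dual_basis (linS (om_linear_l _)).
have /matrixP/(_ a b) := mulVmx gram_unit; rewrite !mxE => <-.
by apply: eq_bigr => c _; rewrite (linZ (om_linear_l _)) mxE.
Qed.

Lemma dual_basis_l a b :
  omega (tnth e b) (dual_basis a) = (-1) ^+ ('[b] && '[a]) * (a == b)%:R.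
Proof.
rewrite /dual_basis (linS (om_linear_r _)) -dual_basisP /dual_basis.
rewrite (linS (om_linear_l _)) mulr_sumr; apply: eq_bigr => c _.
rewrite (linZ (om_linear_l _)) (linZ (om_linear_r _)) /GRing.scale /= mulrCA.
have [ac|/gram_inv_even ->] := eqVneq '[a] '[c]; last by rewrite !mul0r.
by congr (_ * _); have := gram_supersym b c; rewrite !mxE ac.
Qed.

Lemma oproj_dual q a : oproj q (dual_basis a) = if q == '[a] then dual_basis a else 0.
Proof.
rewrite /dual_basis (linS (oproj_linear _)).
case: eqP => [->|/eqP qa].
  apply: eq_bigr => c _; rewrite (linZ (oproj_linear _)).
  have [ac|/gram_inv_even ->] := eqVneq '[a] '[c]; last by rewrite !scale0r.
  by rewrite ac bparityP.
apply: big1 => c _; rewrite (linZ (oproj_linear _)).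
have [ac|/gram_inv_even ->] := eqVneq '[a] '[c]; last by rewrite !scale0r.
by rewrite -(bparityP c) oproj_oproj -ac (negbTE qa) scaler0.
Qed.

Lemma oproj_basis q a : oproj q (tnth e a) = if q == '[a] then tnth e a else 0.
Proof. by rewrite -{1}(bparityP a) oproj_oproj bparityP. Qed.

Lemma X_endE a b c : X_end a b (tnth e c) =
  (c == b)%:R *: tnth e a - ((-1) ^+ ('[a] && '[b]) * gram a c) *: dual_basis b.
Proof.
rewrite /X_end add_lfunE opp_lfunE scale_lfunE sum_lfunE matrix_unitE.
rewrite coord_tnth eq_sym; congr (_ - _); rewrite -scalerA; congr (_ *: _).
rewrite (bigD1 c) //= [X in _ + X]big1 ?addr0 => [|a' a'c].
    rewrite sum_lfunE /dual_basis scaler_sumr; apply: eq_bigr => b' _.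
  by rewrite scale_lfunE matrix_unitE coord_tnth eqxx scale1r scalerA.
rewrite sum_lfunE; apply: big1 => b' _.
by rewrite scale_lfunE matrix_unitE coord_tnth (negbTE a'c) scale0r scaler0.
Qed.

Lemma X_endP a b : osp_condition ('[a] (+) '[b]) (X_end a b).
Proof.
split=> [q|q u w].
  apply: basis_ext => [||c].
  - by move=> k x y; rewrite (oproj_linear q) linearP.
  - by move=> k x y; rewrite linearP (oproj_linear _).
  rewrite oproj_basis X_endE (linD (oproj_linear _)) (linN (oproj_linear _)).
  rewrite !(linZ (oproj_linear _)) oproj_basis oproj_dual.
  have E1 : (q (+) ('[a] (+) '[b]) == '[a]) = (q == '[b]).
    by clear; case: q; case: '[a]; case: '[b].
  have E2 : (q (+) ('[a] (+) '[b]) == '[b]) = (q == '[a]).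
    by clear; case: q; case: '[a]; case: '[b].
  rewrite E1 E2 (fun_if (X_end a b)) linear0 X_endE.
  have [->|cb] := eqVneq c b.
    have [ab|/gram_even ->] := eqVneq '[a] '[b]; last first.
      by rewrite mulr0 !scale0r !subr0; case: eqP; rewrite ?scaler0.
    by rewrite ab; case: eqP; rewrite ?scaler0 ?subr0.
  rewrite !scale0r !sub0r.
  have [ac|/gram_even ->] := eqVneq '[a] '[c]; last by rewrite mulr0 !scale0r oppr0 if_same.
  by rewrite ac; case: eqP; rewrite ?scaler0 ?oppr0.
have lX : linear (X_end a b) by move=> k x y; rewrite linearP.
apply: (@basis_ext K^o (fun u => omega (X_end a b (oproj q u)) w
   + (-1) ^+ (('[a] (+) '[b]) && q) * omega (oproj q u) (X_end a b w)) (fun=> 0)) u => [||c].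
- apply: (@linear_add K V K^o).
    exact: (linear_comp (linear_comp (oproj_linear q) lX) (om_linear_l _)).
  exact: (@linear_scale K V K^o _ _ (linear_comp (oproj_linear q) (om_linear_l _))).
- exact: linear_zero.
apply: (@basis_ext K^o (fun w => omega (X_end a b (oproj q (tnth e c))) w
   + (-1) ^+ (('[a] (+) '[b]) && q) * omega (oproj q (tnth e c)) (X_end a b w)) (fun=> 0)) w => [||d].
- apply: (@linear_add K V K^o); first exact: om_linear_r.
  exact: (@linear_scale K V K^o _ _ (linear_comp lX (om_linear_r _))).
- exact: linear_zero.
rewrite oproj_basis; case: eqP => [->|_]; last first.
  by rewrite linear0 !(lin0 (om_linear_l _)) mulr0 addr0.
rewrite !X_endE (linD (om_linear_l _)) (linD (om_linear_r _)).
rewrite (linN (om_linear_l _)) (linN (om_linear_r _)) !(linZ (om_linear_l _)) !(linZ (om_linear_r _)).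
rewrite dual_basisP dual_basis_l /GRing.scale /=.
have -> : omega (tnth e a) (tnth e d) = gram a d by rewrite mxE.
have -> : omega (tnth e c) (tnth e a) = (-1) ^+ ('[c] && '[a]) * gram a c.
  by have := gram_supersym c a; rewrite !mxE.
rewrite [d == b]eq_sym [b == c]eq_sym.
have H1 : (-1) ^+ ('[a] && '[b]) * gram a c * (b == d)%:R =
  (-1) ^+ (('[a] (+) '[b]) && '[c]) * ((b == d)%:R * ((-1) ^+ ('[c] && '[a]) * gram a c)).
  have [ac|/gram_even ->] := eqVneq '[a] '[c]; last by rewrite !(mulr0, mul0r).
  rewrite -ac; move: (gram a c) (_%:R) => x y; clear.
  by case: '[a]; case: '[b]; rewrite /= ?expr0 ?expr1; ring.
have H2 : (c == b)%:R * gram a d =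
  (-1) ^+ (('[a] (+) '[b]) && '[c]) * ((-1) ^+ ('[a] && '[b]) * gram a d *
    ((-1) ^+ ('[c] && '[b]) * (c == b)%:R)).
  have [->|_] := eqVneq c b; last by rewrite !(mulr0, mul0r).
  move: (gram a d) => x; clear.
  by case: '[a]; case: '[b]; rewrite /= ?expr0 ?expr1; ring.
by rewrite H1 H2 -!mulrBr -mulrDr addrA subrK subrr mulr0.
Qed.

Definition X_osp (a b : 'I_n) : osp V ('[a] (+) '[b]) := Osp (X_endP a b).

(* tau (u (x) w) = (-1)^([u][w]) w (x) u for homogeneous u, w. *)
Definition tau (A B : umodule V) : tens A B -> tens B A :=
  tlift (fun u w => \sum_(p : bool) \sum_(q : bool)
    (-1) ^+ (p && q) *: tpure (proj q w) (proj p u)).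

Definition cap_map : tens V V -> K^o := tlift (@omega K V : V -> V -> K^o).

Definition cup_map (c : K^o) : tens V V := (c : K) *: (\sum_a tpure (tnth e a) (dual_basis a) : tens V V).

(* The action of the tempered Casimir
   t = 1/2 sum_(a, b) X^a_b (x) (-1)^[b] X^b_a. *)
Definition casimir_map (A B : umodule V) (z : tens A B) : tens A B :=
  2^-1 *: \sum_a \sum_b
    super_tmap (S := A) (T := B) (uact A (Ugen (X_osp a b))) ('[b] (+) '[a])
      (fun w => (-1) ^+ '[b] *: uact B (Ugen (X_osp b a)) w) z.

Definition delta_V : K := (sdim V)%:~R.

Section WithModule.
Variable M : umodule V.

Definition letter_module (a : letter) : umodule V :=
  if a is Lm then M else natural_module V.

Fixpoint word_module (s : word) : umodule V :=
  if s is a :: s' then tens_module (letter_module a) (word_module s')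
  else ground_module V.

Fixpoint word_join (s t : word) :
  module_hom (tens_module (word_module s) (word_module t)) (word_module (s ++ t)) :=
  match s with
  | [::] => unit_hom (word_module t)
  | a :: s' => hom_comp (tens_hom (hom_id (letter_module a)) (word_join s' t))
                 (assoc_hom (letter_module a) (word_module s') (word_module t))
  end.

(* The identification of A (x) B with A (x) (B (x) C). *)
Definition pair_module (a b : letter) :
  tens (letter_module a) (letter_module b) -> word_module [:: a; b] :=
  tmap id (fun w => tpure w (1 : K^o)).

(* The C-linear monoidal functors MPB(sdim V) -> U(g)-modules sending a word to
   the tensor product of the modules of its letters, with the prescribed values
   on the generating morphisms. *)
Record is_mpb_functor
    (Phi : functor (C := MPB delta_V) (D := module_category V) word_module) : Prop := {
  mpb_functor_add : forall (s t : MPB delta_V) (f g : mor K s t) x,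
    fmap Phi (Add f g) x = fmap Phi f x + fmap Phi g x;
  mpb_functor_scale : forall (s t : MPB delta_V) a (f : mor K s t) x,
    fmap Phi (Scale a f) x = a *: fmap Phi f x;
  mpb_functor_tens : forall (s t s' t' : MPB delta_V) (f : mor K s t) (g : mor K s' t') z,
    fmap Phi (Tens f g) (word_join s s' z) = word_join t t' (tmap (fmap Phi f) (fmap Phi g) z);
  mpb_functor_cross : forall a b (z : tens (letter_module a) (letter_module b)),
    fmap Phi (XX [:: a] [:: b]) (pair_module z) = pair_module (tau z);
  mpb_functor_cup : forall c : K^o,
    fmap Phi Cup c = pair_module (a := Lv) (b := Lv) (cup_map c);
  mpb_functor_cap : forall z : tens (letter_module Lv) (letter_module Lv),
    fmap Phi Cap (pair_module z) = cap_map z;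
  mpb_functor_HH : forall a b (z : tens (letter_module a) (letter_module b)),
    fmap Phi (HH a b) (pair_module z) = pair_module (casimir_map z) }.

Lemma word_module_strands r : word_module (strands r) = tens_pow V r.
Proof. by elim: r => //= r ->. Qed.
Lemma word_module_polar r : word_module (polar r) = pole_pow M r.
Proof. by rewrite /= word_module_strands. Qed.

(* The functor F_M. *)
#[local] Obligation Tactic := idtac.
Program Definition restrict_PB
    (Phi : functor (C := MPB delta_V) (D := module_category V) word_module) :
    @functor (PB delta_V) (TM_cat M) (fun r => r) :=
  @Functor (PB delta_V) (TM_cat M) _
    (fun r s f => hom_cast (word_module_polar r) (word_module_polar s)
       (fmap Phi (x := polar r) (y := polar s) f)) _ _ _.
Next Obligation.
by move=> Phi r s f g fg; apply: hom_cast_eq; exact: (fmap_heq Phi fg).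
Qed.
Next Obligation.
move=> Phi r x.
apply: (etrans (hom_cast_eq _ _ (fmap_id Phi (polar r)) x)).
exact: (congr1 (fun h : module_hom (pole_pow M r) (pole_pow M r) => h x)
  (hom_cast_id (word_module_polar r))).
Qed.
Next Obligation.
move=> Phi r s t g f x.
apply: (etrans (hom_cast_eq _ _ (fmap_cmp Phi g f) x)).
exact: (congr1 (fun h : module_hom (pole_pow M r) (pole_pow M t) => h x)
  (hom_cast_comp _ _ _ _ _)).
Qed.

End WithModule.

(* The identification of V (x) V with V (x) (V (x) C). *)
Definition pow_pair : tens V V -> tens_pow V 2 := tmap id (fun w => tpure w (1 : K^o)).

(* The C-linear monoidal functor B(sdim V) -> T(V) with the prescribed values on
   the generating morphisms. *)
Record is_brauer_functor
    (F : functor (C := Brauer delta_V) (D := T_cat V) (fun r => r)) : Prop := {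
  brauer_functor_add : forall (r s : Brauer delta_V) (f g : mor K (strands r) (strands s)) x,
    fmap F (x := r) (y := s) (Add f g) x = fmap F (x := r) (y := s) f x + fmap F (x := r) (y := s) g x;
  brauer_functor_scale : forall (r s : Brauer delta_V) a (f : mor K (strands r) (strands s)) x,
    fmap F (x := r) (y := s) (Scale a f) x = a *: fmap F (x := r) (y := s) f x;
  brauer_functor_tens : forall (r s r' s' : Brauer delta_V)
      (f : mor K (strands r) (strands s)) (g : mor K (strands r') (strands s')) z,
    fmap F (x := (r + r')%N) (y := (s + s')%N) (Brauer_tensor_hom f g) (pow_join V r r' z)
      = pow_join V s s' (tmap (fmap F (x := r) (y := s) f) (fmap F (x := r') (y := s') g) z);
  brauer_functor_id : forall x, fmap F (x := 1%N) (y := 1%N) (Id [:: Lv]) x = x;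
  brauer_functor_cross : forall z : tens (natural_module V) (natural_module V),
    fmap F (x := 2) (y := 2) (XX [:: Lv] [:: Lv]) (pow_pair z) = pow_pair (tau z);
  brauer_functor_cup : forall c : K^o,
    fmap F (x := 0%N) (y := 2) Cup c = pow_pair (cup_map c);
  brauer_functor_cap : forall z : tens V V,
    fmap F (x := 2) (y := 0%N) Cap (pow_pair z) = cap_map z }.

End Functors.

(* Main.v *)
Require Import Defs.
From mathcomp Require Import all_boot all_order all_algebra.
From mathcomp Require Import boolp reals complex.

(** Both composites send a pair (f, g), with f : m v^r -> m v^r' and
    g : v^s -> v^s', to an operator on M (x) V^(r + s).  One is the value of the
    functor Phi on f (x) g; as Phi is monoidal, this is Phi f (x) Phi g, read
    through the identification of (M (x) V^r) (x) V^s with M (x) V^(r + s).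
    The other is Phi f (x) F g.  The content is therefore that F and Phi have
    the same value on every morphism g between pole-free words
    ([functors_agree_mor]): they are two monoidal functors with the same values
    on I, X, cup and cap.

    This uses two facts about the presentation of MPB.

    First, Brauer diagrams are generated by I, X, cup and cap
    ([generated_diagram]).  A bottom point is bent up to the top row, and bending
    it back is a composition with a cap.  A diagram whose points all lie in the
    top row is treated by adjacent transpositions, which bring the partner of
    the first point next to it; then a cup splits off.  All stackings in this
    argument are free of closed loops, so no power of delta intervenes, and the
    conclusion holds for delta = 0 too.

    Second, a formal morphism between pole-free words may be written through
    words that contain poles, or with HH.  A formal morphism between a pole-free
    word and a word with a pole is equivalent to zero ([poleless_zero]), as no
    diagram joins them, so such detours contribute nothing on either side; and
    HH(v, v) = X - E is a combination of diagrams.  An induction on formal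
    morphisms concludes. *)

Set Implicit Arguments.
Unset Strict Implicit.
Unset Printing Implicit Defensive.

Import GRing.Theory.
Local Open Scope ring_scope.

(** * Brauer diagrams are generated by identities, crossings, cups and caps *)

Section Generation.
Context {K : fieldType} {delta : K}.

(** The morphisms on which a monoidal functor is determined by its values on the
    crossing, the cup and the cap; closing under [mpb_eq] makes this a condition on
    morphisms of MPB and not on the expressions that represent them. *)
Inductive generated : forall s t : word, mor K s t -> Prop :=
| generated_eq s t (f g : mor K s t) : mpb_eq delta f g -> generated f -> generated g
| generated_comp s t u (g : mor K t u) (f : mor K s t) :
    generated g -> generated f -> generated (Comp g f)
| generated_tens s t s' t' (f : mor K s t) (g : mor K s' t') :
    generated f -> generated g -> generated (Tens f g)
| generated_id r : generated (Id (strands r))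
| generated_cross : generated (XX [:: Lv] [:: Lv])
| generated_cup : generated Cup
| generated_cap : generated Cap.

Lemma diagram_ext s t (A B : diagram s t) : A =1 B -> A = B.
Proof.
move=> AB; have {}AB : partner A = partner B by apply/ffunP.
by case: A B AB => [A hA] [B hB] /= AB; subst B; congr Diagram; exact: bool_irrelevance.
Qed.

Lemma partnerK s t (D : diagram s t) : involutive D.
Proof. by move=> x; have /forallP/(_ x)/and4P[/eqP] := partnerP D. Qed.

Lemma partner_neq s t (D : diagram s t) x : D x != x.
Proof. by have /forallP/(_ x)/and4P[] := partnerP D. Qed.

Lemma point_letter_strands r s (x : point (strands r) (strands s)) : point_letter x = Lv.
Proof. by case: x => i /=; rewrite nth_nseq if_same. Qed.

(** Bending a strand, permuting the points and deleting matched points all have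
    the form of a pull-back of a matching along an injection h whose image is
    stable.  With all letters equal to v, a matching is just an involution without
    fixed points, so the pull-back is again a diagram. *)
Lemma sub_diagram r s r' s' (D : diagram (strands r) (strands s))
    (h : point (strands r') (strands s') -> point (strands r) (strands s)) :
  injective h -> (forall x, exists y, D (h x) = h y) ->
  exists D' : diagram (strands r') (strands s'), forall x, h (D' x) = D (h x).
Proof.
move=> hI hD.
pose p : {ffun _ -> _} := [ffun x => odflt x [pick y | h y == D (h x)]].
have pE x : h (p x) = D (h x).
  rewrite ffunE; case: pickP => [y /eqP //|no].
  by have [y hy] := hD x; have := no y; rewrite hy eqxx.
have pP : is_matching p.
  apply/forallP => x; rewrite !point_letter_strands !eqxx implybT !andbT.
  rewrite -(inj_eq hI) !pE partnerK eqxx /=.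
  by apply: contraNneq (partner_neq D (h x)) => e; rewrite -pE e.
by exists (Diagram pP).
Qed.

Lemma right_point_inj s t s' t' : injective (@right_point s t s' t').
Proof.
pose v (x : point (s ++ s') (t ++ t')) : nat := match x with inl i => i | inr j => j end.
by case=> i [] k // /(congr1 v)/= /addnI ik; [congr inl | congr inr]; exact: val_inj.
Qed.

Lemma juxtapose_exists s t s' t' (A : diagram s t) (B : diagram s' t') :
  exists D, juxtaposes A B D.
Proof.
pose cut (x : point (s ++ s') (t ++ t')) : point s t + point s' t' :=
  match x with
  | inl i => match split_word i with inl j => inl (inl j) | inr j => inr (inl j) end
  | inr i => match split_word i with inl j => inl (inr j) | inr j => inr (inr j) end
  end.
pose glue (y : point s t + point s' t') : point (s ++ s') (t ++ t') :=
  match y with inl x => left_point s' t' x | inr x => right_point s t x end.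
have cutK : cancel cut glue.
  by case=> i; rewrite /cut -[in RHS](split_wordK i); case: (split_word i).
have glueK : cancel glue cut.
  by case=> -[i|i]; rewrite /cut /= ?split_lshift ?split_rshift.
pose p : {ffun point (s ++ s') (t ++ t') -> point (s ++ s') (t ++ t')} :=
  [ffun x => match cut x with inl y => glue (inl (A y)) | inr y => glue (inr (B y)) end].
have pL y : p (glue (inl y)) = glue (inl (A y)) by rewrite ffunE glueK.
have pR y : p (glue (inr y)) = glue (inr (B y)) by rewrite ffunE glueK.
have glI := can_inj glueK.
have letL y : point_letter (glue (inl y)) = point_letter y.
  by case: y => i /=; rewrite nth_cat ltn_ord.
have letR y : point_letter (glue (inr y)) = point_letter y.
  by case: y => i /=; rewrite nth_cat ltnNge leq_addr /= addKn.
have botL y : is_bottom (glue (inl y)) = is_bottom y by case: y.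
have botR y : is_bottom (glue (inr y)) = is_bottom y by case: y.
have pP : is_matching p.
  apply/forallP => x; rewrite -(cutK x); case: (cut x) => y.
    rewrite !pL !letL !botL !(inj_eq glI).
    by have /forallP/(_ y)/and4P[h1 h2 h3 h4] := partnerP A; apply/and4P.
  rewrite !pR !letR !botR !(inj_eq glI).
  by have /forallP/(_ y)/and4P[h1 h2 h3 h4] := partnerP B; apply/and4P.
by exists (Diagram pP); split=> x; [exact: pL | exact: pR].
Qed.

Lemma generated_juxtapose s t s' t' (A : diagram s t) (B : diagram s' t') D :
  juxtaposes A B D -> generated (Diag K A) -> generated (Diag K B) ->
  generated (Diag K D).
Proof.
move=> jD gA gB; apply: generated_eq (generated_tens gA gB).
exact: mpb_juxtapose jD.
Qed.

Section Stack.
Variables (s t u : word) (B : diagram t u) (A : diagram s t).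
Local Notation linked := (connect (stack_edge B A)).

Lemma linked_lower p : linked (lower_point u p) (lower_point u (A p)).
Proof.
by apply: connect1; apply/orP; left; apply/existsP; exists p; rewrite !eqxx.
Qed.

Lemma linked_upper p : linked (upper_point s p) (upper_point s (B p)).
Proof.
by apply: connect1; apply/orP; right; apply/existsP; exists p; rewrite !eqxx.
Qed.

Lemma linked_sym x y : linked x y = linked y x.
Proof.
apply: sym_connect_sym => {}x {}y.
suff E a b : stack_edge B A a b -> stack_edge B A b a by apply/idP/idP; exact: E.
case/orP=> /existsP[p /andP[/eqP -> /eqP ->]]; apply/orP.
  by left; apply/existsP; exists (A p); rewrite partnerK !eqxx.
by right; apply/existsP; exists (B p); rewrite partnerK !eqxx.
Qed.

(** Row and position in the row.  Points of the same stack obtained by different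
    shifts of words are compared through these numbers, which compute. *)
Definition coords (x : stack_point s t u) : nat * nat :=
  match x with
  | inl (inl i) => (0, nat_of_ord i)
  | inl (inr j) => (1, nat_of_ord j)
  | inr k => (2, nat_of_ord k)
  end.

Lemma coords_inj : injective coords.
Proof.
by case=> [[i|j]|k] [[i'|j']|k'] //= [] e; [congr (inl (inl _)) | congr (inl (inr _)) | congr inr];
  exact: val_inj.
Qed.

Definition middle (j : 'I_(size t)) : stack_point s t u := inl (inr j).

(** A component without outer points consists of middle points only, so there is no
    closed loop as soon as each middle point is linked to an outer one. *)
Lemma stacks_no_loop (D : diagram s u) :
  (forall p, linked (outer_point t p) (outer_point t (D p))) ->
  (forall j, exists p, linked (middle j) (outer_point t p)) ->
  stacks B A D 0.
Proof.
move=> hD hm; split=> //; apply/esym/eqP; rewrite cards_eq0; apply/eqP/setP => S.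
rewrite !inE; apply: negbTE; apply/negP => /andP[/imsetP[x _ ->] /forallP no].
suff [p hp] : exists p, linked x (outer_point t p) by have := no p; rewrite inE hp.
case: x {no} => [[i|j]|k]; last by exists (inr k); exact: connect0.
  by exists (inl i); exact: connect0.
exact: hm.
Qed.

Lemma generated_stack (D : diagram s u) :
  (forall p, linked (outer_point t p) (outer_point t (D p))) ->
  (forall j, exists p, linked (middle j) (outer_point t p)) ->
  generated (Diag K B) -> generated (Diag K A) -> generated (Diag K D).
Proof.
move=> hD hm gB gA; apply: generated_eq (generated_comp gB gA).
apply: mpb_trans; first exact: mpb_stack (stacks_no_loop hD hm).
by rewrite expr0; exact: mpb_scale1.
Qed.

End Stack.

Definition swapn (j i : nat) : nat :=
  if i == j then j.+1 else if i == j.+1 then j else i.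

Lemma swapnK j : involutive (swapn j).
Proof.
move=> i; rewrite /swapn; have [->|ij] := eqVneq i j.
  by rewrite eqxx -[j.+1 == j]/(j.+1 == j) gtn_eqF.
have [->|ij'] := eqVneq i j.+1; first by rewrite eqxx.
by rewrite (negbTE ij) (negbTE ij').
Qed.

Lemma swapn_lt m j i : (j.+1 < m)%N -> (i < m)%N -> (swapn j i < m)%N.
Proof.
by move=> jm im; rewrite /swapn; case: ifP => // _; case: ifP => // _; exact: ltnW.
Qed.

(** The default value i of [insubd] is never used when j.+1 < m. *)
Definition swap_ord m (j : nat) (i : 'I_m) : 'I_m := insubd i (swapn j i).

Lemma val_swap_ord m j (i : 'I_m) : (j.+1 < m)%N -> swap_ord j i = swapn j i :> nat.
Proof. by move=> jm; rewrite val_insubd swapn_lt. Qed.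

Lemma swap_ordK m j : (j.+1 < m)%N -> involutive (@swap_ord m j).
Proof. by move=> jm i; apply: ord_inj; rewrite !val_swap_ord // swapnK. Qed.

(** The diagram of the adjacent transposition (j, j.+1) is id (x) X (x) id; the
    identity strands on the left are added one at a time. *)
Lemma generated_swap n j : (j.+1 < n)%N ->
  exists2 B : diagram (strands n) (strands n), generated (Diag K B) &
    forall i, B (inl i) = inr (swap_ord j i) /\ B (inr i) = inl (swap_ord j i).
Proof.
elim: n j => // n IH [|j] jn.
  case: n IH jn => // n _ _.
  have [B jB] := juxtapose_exists (cross_diagram [:: Lv] [:: Lv]) (id_diagram (strands n)).
  exists B; first exact: generated_juxtapose jB generated_cross (generated_id n).
  case: jB => BL BR i.
  have [hL hR] : (forall k : 'I_(size [:: Lv; Lv]),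
        lshift_word (strands n) (@cross_fun [:: Lv] [:: Lv] k)
        = swap_ord 0 (lshift_word (strands n) k : 'I_(size (strands n.+2)))) /\
      (forall k : 'I_(size (strands n)), rshift_word [:: Lv; Lv] k
        = swap_ord 0 (rshift_word [:: Lv; Lv] k : 'I_(size (strands n.+2)))).
    split=> k; apply: ord_inj; rewrite val_swap_ord //=.
    rewrite -(@split_wordK [:: Lv] [:: Lv] k) /cross_fun.
    by case: (@split_word [:: Lv] [:: Lv] k) => -[[|//] ?]; rewrite ?split_lshift ?split_rshift.
  rewrite -(@split_wordK [:: Lv; Lv] (strands n) i);
  case: (@split_word [:: Lv; Lv] (strands n) i) => k.
    have := BL (inl k); have := BL (inr k).
    by rewrite !ffunE /= => -> ->; rewrite hL.
  have := BR (inl k); have := BR (inr k).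
  by rewrite !ffunE /= => -> ->; rewrite -hR.
have [B gB BE] := IH j jn.
have [B' jB] := juxtapose_exists (id_diagram [:: Lv]) B.
exists B'; first exact: generated_juxtapose jB (generated_id 1) gB.
case: jB => BL BR i.
have hL (k : 'I_(size [:: Lv])) : lshift_word (strands n) k
    = swap_ord j.+1 (lshift_word (strands n) k : 'I_(size (strands n.+1))).
  apply: ord_inj; rewrite val_swap_ord /= ?size_nseq //.
  by case: k => [[|]].
have hR (k : 'I_(size (strands n))) : rshift_word [:: Lv] (swap_ord j k)
    = swap_ord j.+1 (rshift_word [:: Lv] k : 'I_(size (strands n.+1))).
  apply: ord_inj; rewrite val_swap_ord /= ?size_nseq // val_swap_ord ?size_nseq //.
  by rewrite /swapn !add1n !eqSS; case: ifP => // _; case: ifP.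
rewrite -(@split_wordK [:: Lv] (strands n) i); case: (@split_word [:: Lv] (strands n) i) => k.
  have := BL (inl k); have := BL (inr k).
  by rewrite !ffunE /= => -> ->; rewrite -hL.
have [e1 e2] := BE k.
have := BR (inl k); have := BR (inr k).
by rewrite e1 e2 /= => -> ->; rewrite hR.
Qed.

(** Induction on the number of points, then on the distance from the first point to
    its partner.  If they are adjacent, the diagram is a cup next to a smaller one;
    otherwise an adjacent transposition brings the partner one step closer. *)
Lemma generated_from_empty n (D : diagram [::] (strands n)) : generated (Diag K D).
Proof.
elim/ltn_ind: n D => -[|[|n]] IH D.
- suff -> : D = id_diagram [::] by exact: (generated_id 0).
  by apply: diagram_ext => -[[]|[]].
- have := partner_neq D (inr ord0).
  by case: (D _) => [[]//|i]; rewrite (ord1 i) eqxx.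
have [j] : exists j, D (inr ord0) = inr (lift ord0 j).
  have := partner_neq D (inr ord0).
  case: (D _) => [[]//|i]; case: (unliftP ord0 i) => [j -> _|->]; first by exists j.
  by rewrite eqxx.
elim: (nat_of_ord j) {-2}j (erefl (nat_of_ord j)) D => {j} [|m IHm] j jm D Dj.
  (* Here D = cup (x) D', with D' the pull-back along the shift by two points. *)
  pose h (x : point [::] (strands n)) : point [::] (strands n.+2) :=
    right_point [::] [:: Lv; Lv] x.
  have hI : injective h by exact: (@right_point_inj [::] [:: Lv; Lv] [::] (strands n)).
  have D0 : D (inr ord0) = inr (lift ord0 ord0).
    by rewrite Dj; congr (inr (lift _ _)); exact: ord_inj.
  have D1 : D (inr (lift ord0 ord0)) = inr ord0 by rewrite -D0 partnerK.
  have hP x : x = inr ord0 \/ x = inr (lift ord0 ord0) \/ exists y, x = h y.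
    case: x => [[]//|i]; case: (unliftP ord0 i) => [k ->|->]; last by left.
    right; case: (unliftP ord0 k) => [k' ->|->]; last by left.
    by right; exists (inr k'); congr inr; exact: ord_inj.
  have [D' D'E] : exists D' : diagram (strands 0) (strands n), forall x, h (D' x) = D (h x).
    apply: (@sub_diagram 0 n.+2 0 n D h) => // x.
    pose pos (y : point [::] (strands n.+2)) : nat := if y is inr k then k else 0.
    case: (hP (D (h x))) => [e|[e|//]]; have := partnerK D (h x); rewrite e ?D0 ?D1;
      by case: x {e} => [[]//|i] /(congr1 pos).
  have jD : juxtaposes cup_diagram D' D.
    split=> [x|x]; last exact: esym (D'E x).
    case: x => [[]//|[[|[|//]] p]]; rewrite !ffunE.
      apply: (etrans (y := D (inr ord0))); first by congr (D (inr _)); exact: ord_inj.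
      by rewrite D0; congr inr; exact: ord_inj.
    apply: (etrans (y := D (inr (lift ord0 ord0)))); first by congr (D (inr _)); exact: ord_inj.
    by rewrite D1; congr inr; exact: ord_inj.
  exact: generated_juxtapose jD generated_cup (IH n (ltnW (ltnSn n.+1)) D').
(* The partner of the first point is at position m.+2; D' is D with the points
   m.+1 and m.+2 exchanged, so that D is the transposition stacked on D'. *)
have lt_m : (m.+2 < n.+2)%N.
  have : (j < size (strands n.+1))%N := ltn_ord j.
  by rewrite jm /strands size_nseq.
have lt_m' : (m.+2 < size (strands n.+2))%N by rewrite size_nseq.
have [B gB BE] := generated_swap lt_m.
pose sw := @swap_ord (size (strands n.+2)) m.+1.
have swK : involutive sw by exact: swap_ordK.
pose h (x : point [::] (strands n.+2)) : point [::] (strands n.+2) :=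
  if x is inr i then inr (sw i) else x.
have hK : involutive h by case=> [[]//|i] /=; rewrite swK.
have [D' D'E] : exists D' : diagram (strands 0) (strands n.+2), forall x, h (D' x) = D (h x).
  apply: (@sub_diagram 0 n.+2 0 n.+2 D h); first exact: inv_inj.
  by move=> x; exists (h (D (h x))); rewrite hK.
have lj : (m < size (strands n.+1))%N by rewrite size_nseq -ltnS ltnW.
have gD' : generated (Diag K D').
  apply: (IHm (Ordinal lj)) => //; apply: (inv_inj hK); rewrite D'E /=.
  have -> : sw ord0 = ord0 by apply: ord_inj; rewrite val_swap_ord.
  rewrite Dj; congr inr; apply: ord_inj; rewrite val_swap_ord //= /bump jm /=.
  by rewrite /swapn eqxx.
have up i : connect (stack_edge B D')
    (middle [::] (t := strands n.+2) (strands n.+2) (sw i)) (outer_point (strands n.+2) (inr i)).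
  have := linked_upper B D' (inr i); rewrite linked_sym.
  by have [_ ->] := BE i.
apply: (generated_stack (B := B) (A := D')) => //.
  case=> [[]//|i]; rewrite linked_sym; apply: connect_trans (up i).
  have [k Dk] : exists k, D (inr i) = inr k by case: (D _) => [[]//|k]; exists k.
  rewrite Dk linked_sym; apply: connect_trans (up k).
  have := linked_lower B D' (inr (sw i)).
  suff -> : D' (inr (sw i)) = inr (sw k) by [].
  by apply: (inv_inj hK); rewrite D'E /= !swK.
by move=> i; exists (inr (sw i)); have := up (sw i); rewrite swK.
Qed.

(** Induction on the number of bottom points: bending the first one up gives D', and
    D = (cap (x) id) (id (x) D') since the cap turns the new top strand of D' down
    again. *)
Theorem generated_diagram r s (D : diagram (strands r) (strands s)) : generated (Diag K D).
Proof.
elim: r s D => [|r IH] s D; first exact: generated_from_empty.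
pose h (x : point (strands r) (strands s.+1)) : point (strands r.+1) (strands s) :=
  match x with
  | inl i => inl (lift ord0 i)
  | inr j => if unlift ord0 j is Some k then inr k else inl ord0
  end.
pose h' (x : point (strands r.+1) (strands s)) : point (strands r) (strands s.+1) :=
  match x with
  | inl i => if unlift ord0 i is Some k then inl k else inr ord0
  | inr j => inr (lift ord0 j)
  end.
have hK : cancel h h'.
  case=> i /=; first by rewrite liftK.
  by case: unliftP => [k ->|->] //=; rewrite unlift_none.
have h'K : cancel h' h.
  case=> i /=; last by rewrite liftK.
  by case: unliftP => [k ->|->] //=; rewrite unlift_none.
have [D' D'E] : exists D' : diagram (strands r) (strands s.+1), forall x, h (D' x) = D (h x).
  apply: (@sub_diagram r.+1 s r s.+1 D h); first exact: can_inj hK.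
  by move=> x; exists (h' (D (h x))); rewrite h'K.
have [A jA] := juxtapose_exists (id_diagram [:: Lv]) D'.
have [B jB] := juxtapose_exists cap_diagram (id_diagram (strands s)).
have gA : generated (Diag K A) by exact: generated_juxtapose jA (generated_id 1) (IH _ _).
have gB : generated (Diag K B) by exact: generated_juxtapose jB generated_cap (generated_id s).
case: jA => AL AR; case: jB => BL BR.
pose mid := middle (strands r.+1) (t := strands s.+2) (strands s).
pose low (x : point (strands r) (strands s.+1)) :
    stack_point (strands r.+1) (strands s.+2) (strands s) :=
  lower_point (strands s) (right_point [:: Lv] [:: Lv] x).
(* The bent strand runs from the first bottom point up to the first middle point,
   and the cap joins this one to the second middle point, where D' starts. *)
have turn_A : connect (stack_edge B A) (mid ord0)
    (outer_point (strands s.+2) (inl ord0 : point (strands r.+1) (strands s))).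
  pose o : point [:: Lv] [:: Lv] := inl ord0.
  have := linked_lower B A (left_point (strands r) (strands s.+1) o).
  rewrite AL !ffunE linked_sym.
  by congr (connect _ _ _); exact: coords_inj.
have turn_B : connect (stack_edge B A) (mid (lift ord0 ord0)) (mid ord0).
  pose o : point [:: Lv; Lv] [::] := inl ord0.
  have := linked_upper B A (left_point (strands s) (strands s) o).
  rewrite BL !ffunE linked_sym.
  by congr (connect _ _ _); exact: coords_inj.
have bend x : connect (stack_edge B A) (low x) (outer_point (strands s.+2) (h x)).
  case: x => [i|j].
    by apply: eq_connect0; exact: coords_inj.
  case: (unliftP ord0 j) => [k ->|->]; rewrite /h ?liftK ?unlift_none.
    have := linked_upper B A (right_point [:: Lv; Lv] [::] (inr k)).
    rewrite BR !ffunE linked_sym.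
    by congr (connect _ _ _); exact: coords_inj.
  apply: connect_trans turn_A; apply: etrans turn_B.
  by congr (connect _ _ _); exact: coords_inj.
apply: (generated_stack (B := B) (A := A)) => //.
  move=> p; rewrite -(h'K p) -D'E.
  rewrite linked_sym; apply: connect_trans (bend _); rewrite linked_sym.
  apply: connect_trans (bend _).
  by have := linked_lower B A (right_point [:: Lv] [:: Lv] (h' p)); rewrite AR.
move=> j; case: (unliftP ord0 j) => [k ->|->]; last by exists (inl ord0).
exists (h (inr k)); apply: connect_trans (bend (inr k)).
by apply: eq_connect0; exact: coords_inj.
Qed.

End Generation.

(** * Morphisms that change the presence of a pole vanish *)

Section ZeroMorphisms.
Context {K : fieldType} {delta : K}.

Definition poleless (s : word) : bool := all (pred1 Lv) s.

Lemma poleless_diagram s t (D : diagram s t) : poleless s = poleless t.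
Proof.
have match_letter x : (point_letter (D x) == point_letter x)
    && ((is_bottom (D x) == is_bottom x) ==> (point_letter x == Lv)).
  by have /forallP/(_ x)/and4P[_ _ -> ->] := partnerP D.
apply/idP/idP => /(all_nthP Lv) H; apply/(all_nthP Lv) => i lti /=.
  have := match_letter (inr (Ordinal lti)).
  by case: (D _) => j /= /andP[/eqP <- //] _; exact: (H _ (ltn_ord j)).
have := match_letter (inl (Ordinal lti)).
by case: (D _) => j /= /andP[/eqP <- //] _; exact: (H _ (ltn_ord j)).
Qed.

Lemma mpb_comp0l s t u (f : mor K s t) : mpb_eq delta (Comp (Zero K t u) f) (Zero K s u).
Proof.
apply: mpb_trans (mpb_comp _ (mpb_refl _ f)) _.
  by apply: mpb_sym; exact: (mpb_scale0 _ (Zero K t u)).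
by apply: mpb_trans (mpb_compZl _ _ _ _) _; exact: mpb_scale0.
Qed.

Lemma mpb_comp0r s t u (g : mor K t u) : mpb_eq delta (Comp g (Zero K s t)) (Zero K s u).
Proof.
apply: mpb_trans (mpb_comp (mpb_refl _ g) _) _.
  by apply: mpb_sym; exact: (mpb_scale0 _ (Zero K s t)).
by apply: mpb_trans (mpb_compZr _ _ _ _) _; exact: mpb_scale0.
Qed.

Lemma mpb_tens0l s t s' t' (f : mor K s' t') :
  mpb_eq delta (Tens (Zero K s t) f) (Zero K _ _).
Proof.
apply: mpb_trans (mpb_tens _ (mpb_refl _ f)) _.
  by apply: mpb_sym; exact: (mpb_scale0 _ (Zero K s t)).
by apply: mpb_trans (mpb_tensZl _ _ _ _) _; exact: mpb_scale0.
Qed.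

Lemma mpb_tens0r s t s' t' (f : mor K s t) :
  mpb_eq delta (Tens f (Zero K s' t')) (Zero K _ _).
Proof.
apply: mpb_trans (mpb_tens (mpb_refl _ f) _) _.
  by apply: mpb_sym; exact: (mpb_scale0 _ (Zero K s' t')).
by apply: mpb_trans (mpb_tensZr _ _ _ _) _; exact: mpb_scale0.
Qed.

(** Poles run from bottom to top in every diagram.  A composite or a tensor product
    that changes the presence of a pole has a factor that changes it, and this
    factor, zero by induction, makes the whole zero. *)
Lemma poleless_zero s t (f : mor K s t) :
  poleless s != poleless t -> mpb_eq delta f (Zero K s t).
Proof.
elim: f => {s t}.
- by move=> s t D; rewrite (poleless_diagram D) eqxx.
- by move=> a b; rewrite eqxx.
- by move=> s t _; exact: mpb_refl.
- move=> s t f IHf g IHg ne.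
  by apply: mpb_trans (mpb_add (IHf ne) (IHg ne)) _; exact: mpb_add0.
- move=> s t a f IH ne; apply: mpb_trans (mpb_scale a (IH ne)) _.
  apply: mpb_trans (mpb_scale a (mpb_sym (mpb_scale0 _ (Zero K s t)))) _.
  by apply: mpb_trans (mpb_scaleA _ _ _ _) _; rewrite mulr0; exact: mpb_scale0.
- move=> s t u g IHg f IHf ne; have [e|ne'] := eqVneq (poleless s) (poleless t).
    apply: mpb_trans (mpb_comp (IHg _) (mpb_refl _ f)) _; first by rewrite -e.
    exact: mpb_comp0l.
  apply: mpb_trans (mpb_comp (mpb_refl _ g) (IHf ne')) _; exact: mpb_comp0r.
move=> s t s' t' f IHf g IHg; rewrite /poleless !all_cat -!/(poleless _) => ne.
have [e|ne'] := eqVneq (poleless s) (poleless t).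
  apply: mpb_trans (mpb_tens (mpb_refl _ f) (IHg _)) _; last exact: mpb_tens0r.
  by apply: contraNneq ne => ->; rewrite e.
apply: mpb_trans (mpb_tens (IHf ne') (mpb_refl _ g)) _; exact: mpb_tens0l.
Qed.

End ZeroMorphisms.

(** * Tensor joins of words and of powers of V *)

Section Transport.
Context {K : fieldType} {V : ortho_space K}.
Implicit Types A B C D : umodule V.

(** The modules of a word v^r and of its juxtapositions are only propositionally equal
    to the powers of V.  The equality is made to act on elements, so that casts of
    morphisms become conjugations. *)
Definition iso_of_eq A B (eAB : A = B) : module_hom A B :=
  eq_rect A (module_hom A) (hom_id A) B eAB.

Lemma iso_of_eq_id A (eA : A = A) x : iso_of_eq eA x = x.
Proof. by rewrite (Prop_irrelevance eA erefl). Qed.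

Lemma iso_of_eq_comp A B C (eAB : A = B) (eBC : B = C) (eAC : A = C) x :
  iso_of_eq eBC (iso_of_eq eAB x) = iso_of_eq eAC x.
Proof. by case: C / eBC eAC => eAC; rewrite (Prop_irrelevance eAC eAB). Qed.

Lemma hom_castE A A' B B' (eA : A = A') (eB : B = B') (f : module_hom A B) x :
  hom_cast eA eB f (iso_of_eq eA x) = iso_of_eq eB (f x).
Proof. by case: A' / eA; case: B' / eB. Qed.

Lemma iso_of_eq_inj A B (eAB : A = B) : injective (iso_of_eq eAB).
Proof. by case: B / eAB. Qed.

Lemma tmap_iso_surj A A' B B' (eA : A = A') (eB : B = B') (z : tens A' B') :
  exists z0, z = tmap (iso_of_eq eA) (iso_of_eq eB) z0.
Proof.
case: A' / eA z; case: B' / eB => z; exists z; symmetry; exact: tmap_id.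
Qed.

Lemma iso_unit A B (eAB : A = B) (e1 : ground_module V = ground_module V) z :
  iso_of_eq eAB (unit_hom A z) = unit_hom B (tmap (iso_of_eq e1) (iso_of_eq eAB) z).
Proof.
case: B / eAB; congr (unit_hom A _); rewrite -[LHS]tmap_id.
by apply: eq_tmap => // x; rewrite iso_of_eq_id.
Qed.

(** [word_join], [pow_join] and [pole_join] attach one more factor A on the left by the
    same formula, so their compatibility is proved for a single such step. *)
Lemma iso_join_step A B B' C C' D D' (eB : B = B') (eC : C = C') (eD : D = D')
    (j : module_hom (tens_module B C) D) (j' : module_hom (tens_module B' C') D')
    (eAB : tens_module A B = tens_module A B') (eAD : tens_module A D = tens_module A D') :
  (forall z, iso_of_eq eD (j z) = j' (tmap (iso_of_eq eB) (iso_of_eq eC) z)) ->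
  forall z, iso_of_eq eAD (hom_comp (tens_hom (hom_id A) j) (assoc_hom A B C) z)
    = hom_comp (tens_hom (hom_id A) j') (assoc_hom A B' C')
        (tmap (iso_of_eq eAB) (iso_of_eq eC) z).
Proof.
case: B' / eB j' eAB; case: C' / eC; case: D' / eD eAD => eAD j' eAB jj' z.
have -> : tmap (iso_of_eq eAB) (iso_of_eq erefl) z = z.
  rewrite -[RHS]tmap_id; apply: eq_tmap => // x; exact: iso_of_eq_id.
rewrite iso_of_eq_id; apply: (@eq_tmap K V A (tens_module B C) A D) => // x.
rewrite -[LHS]/(iso_of_eq erefl (j x)) jj'; congr (j' _); exact: tmap_id.
Qed.

Context {M : umodule V}.
Local Notation W := (word_module M).

Lemma iso_word_join r s (e : W (strands r ++ strands s) = tens_pow V (r + s)) z :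
  iso_of_eq e (word_join M (strands r) (strands s) z)
    = pow_join V r s
        (tmap (iso_of_eq (word_module_strands M r)) (iso_of_eq (word_module_strands M s)) z).
Proof.
elim: r e z => [|r IH] e z.
  by rewrite (Prop_irrelevance e (word_module_strands M s)); exact: iso_unit.
have e' : W (strands r ++ strands s) = tens_pow V (r + s).
  by rewrite cat_strands word_module_strands.
exact: iso_join_step (IH e') z.
Qed.

Lemma iso_polar_join r s (e : W (polar r ++ strands s) = pole_pow M (r + s)) z :
  iso_of_eq e (word_join M (polar r) (strands s) z)
    = pole_join M r s
        (tmap (iso_of_eq (word_module_polar M r)) (iso_of_eq (word_module_strands M s)) z).
Proof.
have e' : W (strands r ++ strands s) = tens_pow V (r + s).
  by rewrite cat_strands word_module_strands.
exact: (@iso_join_step M _ _ _ _ _ _ _ _ e' _ _ (word_module_polar M r) e (iso_word_join e')) z.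
Qed.

Lemma fmap_mor_cast (Phi : functor (C := MPB (delta_V V)) (D := module_category V) W)
    s s' t t' (es : s = s') (et : t = t') (f : mor K s t) (es' : W s = W s') (et' : W t = W t') x :
  fmap Phi (mor_cast es et f) (iso_of_eq es' x) = iso_of_eq et' (fmap Phi f x).
Proof.
by case: s' / es es'; case: t' / et et' => *; rewrite !iso_of_eq_id.
Qed.

End Transport.

(** * The two functors agree on pole-free words *)

Section Agreement.
Context {K : fieldType} {V : ortho_space K} {e : homogeneous_basis V} {M : umodule V}.
Variables (Phi : functor (C := MPB (delta_V V)) (D := module_category V) (word_module M))
  (F : functor (C := Brauer (delta_V V)) (D := T_cat V) (fun r => r)).
Hypotheses (HPhi : is_mpb_functor e Phi) (HF : is_brauer_functor e F).
Local Notation W := (word_module M).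

Definition brauer_map r s (f : mor K (strands r) (strands s)) :
  module_hom (tens_pow V r) (tens_pow V s) := fmap F (x := r) (y := s) f.
Definition mpb_map s t (f : mor K s t) : module_hom (W s) (W t) := fmap Phi f.

(** The words s and t are arbitrary, with equations to powers of v, so that induction
    on formal morphisms applies; at words with a pole the condition is empty.  The
    equalities of modules are quantified too, as any two proofs of them are equal. *)
Definition functors_agree s t (f : mor K s t) : Prop :=
  forall r r' (es : s = strands r) (et : t = strands r')
    (es' : W s = tens_pow V r) (et' : W t = tens_pow V r') x,
  brauer_map (mor_cast es et f) (iso_of_eq es' x) = iso_of_eq et' (mpb_map f x).

Lemma functors_agreeI r s (f : mor K (strands r) (strands s)) :
  (forall x, brauer_map f (iso_of_eq (word_module_strands M r) x)
     = iso_of_eq (word_module_strands M s) (mpb_map f x)) -> functors_agree f.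
Proof.
move=> H r' s' er es; have rr' : r = r' by have := congr1 size er; rewrite /strands !size_nseq.
have ss' : s = s' by have := congr1 size es; rewrite /strands !size_nseq.
subst r' s' => er' es' x.
rewrite (eq_irrelevance er erefl) (eq_irrelevance es erefl) /=.
rewrite (Prop_irrelevance er' (word_module_strands M r)).
by rewrite (Prop_irrelevance es' (word_module_strands M s)).
Qed.

Lemma functors_agreeE r s (f : mor K (strands r) (strands s)) x : functors_agree f ->
  brauer_map f (iso_of_eq (word_module_strands M r) x)
    = iso_of_eq (word_module_strands M s) (mpb_map f x).
Proof. by move=> Hf; exact: (Hf r s erefl erefl). Qed.

Lemma functors_agree_eq s t (f g : mor K s t) :
  mpb_eq (delta_V V) f g -> functors_agree f -> functors_agree g.
Proof.
move=> fg H r r' es et es' et' x.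
have <- : mpb_map f x = mpb_map g x by exact: (fmap_heq Phi fg).
have <- : brauer_map (mor_cast es et f) (iso_of_eq es' x)
    = brauer_map (mor_cast es et g) (iso_of_eq es' x).
  exact: (fmap_heq F (x := r) (y := r') (mpb_cast es et fg)).
exact: H.
Qed.

Lemma functors_agree_add s t (f g : mor K s t) :
  functors_agree f -> functors_agree g -> functors_agree (Add f g).
Proof.
move=> Hf Hg r r' es et; subst s t; apply: functors_agreeI => x.
have -> : mpb_map (Add f g) x = mpb_map f x + mpb_map g x by exact: (mpb_functor_add HPhi).
apply: (etrans (brauer_functor_add HF f g _)).
by rewrite (linD (mhom_linear _)) -(functors_agreeE _ Hf) -(functors_agreeE _ Hg).
Qed.

Lemma functors_agree_scale s t a (f : mor K s t) : functors_agree f -> functors_agree (Scale a f).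
Proof.
move=> Hf r r' es et; subst s t; apply: functors_agreeI => x.
have -> : mpb_map (Scale a f) x = a *: mpb_map f x by exact: (mpb_functor_scale HPhi).
apply: (etrans (brauer_functor_scale HF a f _)).
by rewrite (linZ (mhom_linear _)) -(functors_agreeE _ Hf).
Qed.

Lemma functors_agree_zero s t : functors_agree (Zero K s t).
Proof.
apply: (functors_agree_eq (mpb_scale0 _ (Zero K s t))) => r r' es et; subst s t.
apply: functors_agreeI => x.
have -> : mpb_map (Scale 0 (Zero K (strands r) (strands r'))) x
    = 0 *: mpb_map (Zero K (strands r) (strands r')) x.
  exact: (mpb_functor_scale HPhi).
apply: (etrans (brauer_functor_scale HF 0 (Zero K (strands r) (strands r')) _)).
by rewrite !scale0r (lin0 (mhom_linear _)).
Qed.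

Lemma poleless_strands s : poleless s -> s = strands (size s).
Proof. by move/all_pred1P. Qed.

Lemma strands_poleless r : poleless (strands r).
Proof. by rewrite /poleless all_pred1_nseq. Qed.

(** The middle word may have a pole, where agreement of the factors says nothing; but
    then each factor changes the presence of a pole, and the composite is zero. *)
Lemma functors_agree_comp s t u (g : mor K t u) (f : mor K s t) :
  functors_agree g -> functors_agree f -> functors_agree (Comp g f).
Proof.
move=> Hg Hf r r' es eu; subst s u.
have [tv|tp] := boolP (poleless t); last first.
  suff fg0 : mpb_eq (delta_V V) (Comp g f) (Zero K _ _).
    exact: (functors_agree_eq (mpb_sym fg0) (@functors_agree_zero _ _)).
  have f0 : mpb_eq (delta_V V) f (Zero K (strands r) t).
    by apply: poleless_zero; rewrite strands_poleless (negbTE tp).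
  apply: mpb_trans (mpb_comp (mpb_refl _ g) f0) _; exact: mpb_comp0r.
have et := poleless_strands tv; move: (size t) et => n et; subst t.
apply: functors_agreeI => x.
have -> : mpb_map (Comp g f) x = mpb_map g (mpb_map f x) by exact: (fmap_cmp Phi g f x).
rewrite -(functors_agreeE _ Hg) -(functors_agreeE _ Hf).
exact: (fmap_cmp F (x := r) (y := n) (z := r') g f).
Qed.

Lemma functors_agree_tens s t s' t' (f : mor K s t) (g : mor K s' t') :
  functors_agree f -> functors_agree g -> functors_agree (Tens f g).
Proof.
move=> Hf Hg r r' es et.
have split_strands u u' n : u ++ u' = strands n -> u = strands (size u) /\ u' = strands (size u').
  move=> uu'; have := strands_poleless n; rewrite -uu' /poleless all_cat.
  by case/andP=> /poleless_strands ? /poleless_strands.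
have [es1 es2] := split_strands _ _ _ es; have [et1 et2] := split_strands _ _ _ et.
move: (size s) (size s') (size t) (size t') es1 es2 et1 et2 => a a' b b' ? ? ? ?; subst s s' t t'.
have ra : r = (a + a')%N by have := congr1 size es; rewrite size_cat /strands !size_nseq.
have rb : r' = (b + b')%N by have := congr1 size et; rewrite size_cat /strands !size_nseq.
subst r r' => es' et' x.
(* Both functors are prescribed on elements joined from two factors; the joins are
   invertible, so these are all elements. *)
have [z ->] : exists z, x = word_join M (strands a) (strands a') z.
  have [z0 hz0] := tmap_iso_surj (word_module_strands M a) (word_module_strands M a')
    (pow_split V a a' (iso_of_eq es' x)).
  exists z0; apply: (@iso_of_eq_inj _ _ _ _ es').
  by rewrite iso_word_join -hz0 pow_splitK.
rewrite iso_word_join (eq_irrelevance es (cat_strands a a')) (eq_irrelevance et (cat_strands b b')).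
rewrite /mpb_map (mpb_functor_tens HPhi) iso_word_join.
apply: (etrans (brauer_functor_tens HF f g _)); congr (pow_join V b b' _).
rewrite (tmap_comp (iso_of_eq _) (iso_of_eq _) (brauer_map f) (brauer_map g)).
rewrite (tmap_comp (mpb_map f) (mpb_map g) (iso_of_eq _) (iso_of_eq _)).
apply: eq_tmap => y; first exact: (Hf _ _ erefl erefl).
exact: (Hg _ _ erefl erefl).
Qed.

Lemma functors_agree_id r : functors_agree (Id (strands r)).
Proof.
apply: functors_agreeI => x.
have -> : mpb_map (Id (strands r)) x = x by exact: (fmap_id Phi (strands r) x).
exact: (fmap_id F r).
Qed.

(** So the prescribed values of F and Phi on two strands determine operators on the
    whole of V (x) (V (x) K). *)
Lemma pow_pair_surj (z : tens_pow V 2) : exists z0, z = pow_pair z0.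
Proof.
pose Vn := natural_module V.
have absorb_bilin : bilinear_map (fun (w : Vn) (c : K^o) => (c : K) *: w).
  split=> [c a x y|w a x y]; first by rewrite scalerDr !scalerA mulrC.
  by rewrite scalerDl -scalerA.
pose absorb := tlift (fun (w : Vn) (c : K^o) => (c : K) *: w).
have absorb_lin : linear absorb by exact: tlift_linear.
have pure1_lin : linear (fun w : Vn => tpure w (1 : K^o)) := (tpure_bilin Vn K^o).1 1.
exists (tmap id absorb z).
have lin_r : linear (@pow_pair K V \o tmap id absorb).
  by apply: linear_comp; apply: tmap_linear.
apply: (tens_ext (f := id) (g := @pow_pair K V \o tmap id absorb)) z => // u.
apply: (tens_ext (f := tpure u) (g := @pow_pair K V \o tmap id absorb \o tpure u)) => [||w c].
- exact: (tpure_bilin _ _).2.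
- by apply: (linear_comp (f := tpure u)) => //; exact: (tpure_bilin _ _).2.
rewrite /= tmapE // /absorb tlift_pure // /pow_pair tmapE // (linZ pure1_lin).
by rewrite -(linZ ((tpure_bilin Vn K^o).2 w)) /GRing.scale /= mulr1.
Qed.

Lemma functors_agree_cross : functors_agree (XX [:: Lv] [:: Lv]).
Proof.
apply: (@functors_agreeI 2 2) => x; rewrite !iso_of_eq_id; have [z ->] := pow_pair_surj x.
apply: (etrans (brauer_functor_cross HF z)); symmetry.
exact: (mpb_functor_cross HPhi (a := Lv) (b := Lv) z).
Qed.

Lemma functors_agree_cup : functors_agree Cup.
Proof.
apply: (@functors_agreeI 0 2) => x; rewrite !iso_of_eq_id.
apply: (etrans (brauer_functor_cup HF x)); symmetry; exact: (mpb_functor_cup HPhi x).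
Qed.

Lemma functors_agree_cap : functors_agree Cap.
Proof.
apply: (@functors_agreeI 2 0) => x; rewrite !iso_of_eq_id; have [z ->] := pow_pair_surj x.
apply: (etrans (brauer_functor_cap HF z)); symmetry; exact: (mpb_functor_cap HPhi z).
Qed.

Lemma functors_agree_generated s t (f : mor K s t) :
  generated (delta := delta_V V) f -> functors_agree f.
Proof.
elim=> {s t f}.
- by move=> s t f g fg _; exact: functors_agree_eq.
- by move=> s t u g f _ Hg _ Hf; exact: functors_agree_comp.
- by move=> s t s' t' f g _ Hf _ Hg; exact: functors_agree_tens.
- exact: functors_agree_id.
- exact: functors_agree_cross.
- exact: functors_agree_cup.
exact: functors_agree_cap.
Qed.

(** Induction on the expression of a morphism: diagrams are generated, and between
    pole-free words the only adjoined morphism is HH(v, v) = X - cup cap. *)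
Lemma functors_agree_mor s t (f : mor K s t) : functors_agree f.
Proof.
elim: f => {s t}.
- move=> s t D r r' es et; subst s t; apply: functors_agree_generated (erefl _) (erefl _).
  exact: generated_diagram.
- move=> a b r r' es et; have [ea eb] : a = Lv /\ b = Lv.
    by have := strands_poleless r; rewrite -es => /and3P[/eqP -> /eqP ->].
  subst a b; move: r r' es et; apply: (functors_agree_eq (mpb_sym (mpb_HH_vv _))).
  apply: functors_agree_add; first exact: functors_agree_cross.
  by apply: functors_agree_scale; apply: functors_agree_comp;
    [exact: functors_agree_cup | exact: functors_agree_cap].
- exact: functors_agree_zero.
- by move=> s t f Hf g Hg; exact: functors_agree_add.
- by move=> s t a f; exact: functors_agree_scale.
- by move=> s t u g Hg f Hf; exact: functors_agree_comp.
by move=> s t s' t' f Hf g Hg; exact: functors_agree_tens.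
Qed.

End Agreement.

(** * Compatibility with the tensor products *)

Unset Implicit Arguments.
Set Strict Implicit.

Theorem lemma5p11 (R : realType) (V : ortho_space R[i]) (e : homogeneous_basis V)
  (M : umodule V)
  (Phi : functor (C := MPB (delta_V V)) (D := module_category V) (word_module M))
  (F : functor (C := Brauer (delta_V V)) (D := T_cat V) (fun r => r))
  (HPhi : is_mpb_functor e Phi) (HF : is_brauer_functor e F) :
  functor_eq
    (functor_comp (TM_tensor M) (functor_prod (restrict_PB Phi) F))
    (functor_comp (restrict_PB Phi) (PB_tensor (delta_V V))).
Proof.
move=> [r s] [r' s'] [f g] u.
(* Both sides are compared on elements pole_join w, where w comes from a tensor z of
   word modules. *)
have [w ->] : exists w, u = pole_join M r s w by exists (pole_split M r s u); rewrite pole_splitK.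
have [z ->] := tmap_iso_surj (word_module_polar M r) (word_module_strands M s) w.
have eW : word_module M (polar r ++ strands s) = pole_pow M (r + s).
  by rewrite cat_polar word_module_polar.
have eW' : word_module M (polar r' ++ strands s') = pole_pow M (r' + s').
  by rewrite cat_polar word_module_polar.
transitivity (iso_of_eq eW' (fmap Phi (Tens f g) (word_join M (polar r) (strands s) z))).
  (* F_M f is Phi f up to casts, and F g is Phi g by the agreement on pole-free words. *)
  pose f' := fmap (restrict_PB Phi) (x := r) (y := r') f.
  apply: (etrans (congr1 (fun v => pole_join M r' s' (tmap f' (brauer_map F g) v)) (pole_joinK _))).
  rewrite (mpb_functor_tens HPhi) iso_polar_join.
  congr (pole_join M r' s' _).
  rewrite (tmap_comp (iso_of_eq _) (iso_of_eq _) f' (brauer_map F g)).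
  rewrite (tmap_comp (fmap Phi f) (fmap Phi g) (iso_of_eq _) (iso_of_eq _)).
  apply: eq_tmap => y; first exact: hom_castE.
  exact: (functors_agree_mor HPhi HF g (erefl _) (erefl _)).
pose eP := congr1 (word_module M) (cat_polar r s).
pose eP' := congr1 (word_module M) (cat_polar r' s').
rewrite -iso_polar_join -(iso_of_eq_comp eP (word_module_polar M (r + s))).
rewrite -(iso_of_eq_comp eP' (word_module_polar M (r' + s'))).
symmetry; apply: (etrans (hom_castE _ _ _ _)).
congr (iso_of_eq _ _); exact: fmap_mor_cast.
Qed.
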